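(* Fix an integer $k>0$. For any $(k+1)$-core $\lambda$, $$\mathfrak S^{(k)}_\lambda=\sum_A x^A,$$ where the sum is over all affine Bruhat counter-tableaux $A$ (of any $k$-weight) with inner shape $\lambda$, and $x^A=x^{\alpha}=\prod_{i=1}^{r}x_i^{\alpha_i}$ when $A$ has $k$-weight $\alpha=(\alpha_1,\dots,\alpha_r)$.
   Context: Partitions are drawn in French notation: row $i$ (counted from the bottom) of $\lambda=(\lambda_1\ge\lambda_2\ge\cdots)$ consists of the cells $(i,j)$, $1\le j\le\lambda_i$. For $\mu\subseteq\lambda$, $\lambda/\mu$ is the set of cells of $\lambda$ not in $\mu$; it is a horizontal strip if no two of its cells share a column. The hook length of a cell is (cells to its right in its row)+(cells above it in its column)+1. A $(k+1)$-core is a partition with no cell of hook length exactly $k+1$. The residue of cell $(i,j)$ is $(j-i)\bmod(k+1)$. $\deg(\lambda)$ is the number of cells of a core $\lambda$ with hook length $<k+1$. $(k+\lambda_1,\lambda)$ denotes the partition $(k+\lambda_1,\lambda_1,\lambda_2,\dots)$. Strong order on $(k+1)$-cores: $\rho\lessdot_B\gamma$ iff $\rho\subseteq\gamma$ and $\deg(\gamma)=\deg(\rho)+1$. For $0<\ell\le k$ and cores $\lambda,\nu$, $(k+\lambda_1,\lambda)/\nu$ is a bottom strong $\ell$-strip if there is a chain of cores $\nu=\nu^0\lessdot_B\cdots\lessdot_B\nu^{k-\ell}=(k+\lambda_1,\lambda)$ such that $(k+\lambda_1,\lambda)/\nu$ is a horizontal strip and for each $1\le i\le k-\ell$ the rightmost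 cell of the bottom row of $\nu^i$ lies in $\nu^i/\nu^{i-1}$. Dual $k$-Schur function (as defined in this paper): for a $(k+1)$-core $\nu$ and a composition $\alpha=(\alpha_1,\dots,\alpha_r)$ (positive parts) of $\deg(\nu)$, a $k$-tableau of shape $\nu$ and $k$-weight $\alpha$ is a filling of $\nu$ with the integers $1,\dots,r$, weakly increasing along rows left to right and strictly increasing up columns, such that for each $1\le i\le r$ the cells containing $i$ have exactly $\alpha_i$ distinct residues. Then $\mathfrak S^{(k)}_\nu=\sum_T x^{k\text{-weight}(T)}$, summed over all $k$-tableaux $T$ of shape $\nu$ (of any such weight), with $x^\alpha=\prod_{i=1}^r x_i^{\alpha_i}$. Affine Bruhat counter-tableau (ABC): let $\alpha=(\alpha_1,\dots,\alpha_r)$ be a composition with $1\le\alpha_i\le k$. Let $A$ be an array of $r$ left-justified rows numbered $1,\dots,r$ from top to bottom; each cell is either empty or contains a positive integer, empty cells form an initial (leftmost) segment of each row, the entries weakly decrease along each row from left to right, and in each column the entries of nonempty cells strictly decrease from bottom to top (a counter-tableau). For $0\le x\le r$ let $\lambda^{(x)}$ be the sequence whose $j$-th part ($1\le j\le x$) is the number of cells in row $x+1-j$ of $A$ that are empty or contain an integer larger than $x$ (so $\lambda^{(0)}=\emptyset$, and $\lambda^{(x)}$ is drawn with row $x$ of $A$ as its bottom row). $A$ is an ABC of $k$-weight $\alpha$ if for every $1\le i\le r$: the $\lambda^{(i-1)},\lambda^{(i)}$ are $(k+1)$-cores, row $i$ of $A$ has exactly $k+\lambda^{(i-1)}_1$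 cells and contains no entry smaller than $i$, and $(k+\lambda^{(i-1)}_1,\lambda^{(i-1)})/\lambda^{(i)}$ is a bottom strong $\alpha_i$-strip. The inner shape of $A$ is $\lambda^{(r)}$.
   Formalization: The entries of an affine Bruhat counter-tableau with r rows are required to lie in 1,…,r; if arbitrary positive integers were allowed, entries larger than r would act as empty cells and the sum over A would be infinite for every nonempty λ. *)

(* Defs.v *)
From mathcomp Require Import all_boot all_order all_algebra.
From mathcomp Require Import boolp classical_sets functions cardinality fsbigop.
From mathcomp.multinomials Require Import monalg.

Set Implicit Arguments.
Unset Strict Implicit.
Unset Printing Implicit Defensive.

Import GRing.Theory.
Local Open Scope nat_scope.

(* Partitions are lists of positive parts, bottom row first (French notation).
   Rows and columns of diagrams are numbered from 0, so the bottom left cell is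
   (0, 0); this changes neither hook lengths nor residues. *)

Definition is_part (s : seq nat) : bool := sorted geq s && (0 \notin s).

Definition cells (la : seq nat) : seq (nat * nat) :=
  [seq (i, j) | i <- iota 0 (size la), j <- iota 0 (nth 0 la i)].

Definition col_height (la : seq nat) (j : nat) : nat := count (ltn j) la.

Definition hook (la : seq nat) (c : nat * nat) : nat :=
  (nth 0 la c.1 - c.2.+1) + (col_height la c.2 - c.1.+1) + 1.

Definition included (mu la : seq nat) : bool :=
  all (fun c => c \in cells la) (cells mu).

Definition skew_cells (la mu : seq nat) : seq (nat * nat) :=
  [seq c <- cells la | c \notin cells mu].

Definition horizontal_strip (la mu : seq nat) : bool :=
  included mu la && uniq [seq c.2 | c <- skew_cells la mu].

(* The (k+1)-cores: the parameter is k. *)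
Definition is_core (k : nat) (la : seq nat) : bool :=
  is_part la && all (fun c => hook la c != k.+1) (cells la).

Definition deg (k : nat) (la : seq nat) : nat :=
  count (fun c => hook la c < k.+1) (cells la).

Definition residue (k : nat) (c : nat * nat) : int :=
  ((c.2%:Z - c.1%:Z)%R %% k.+1%:Z)%Z.

Definition strong_cover (k : nat) (rho gamma : seq nat) : bool :=
  [&& is_core k rho, is_core k gamma, included rho gamma
    & deg k gamma == (deg k rho).+1].

(* The partition (k + la_1, la). *)
Definition add_row (k : nat) (la : seq nat) : seq nat := k + head 0 la :: la.

(* The rightmost cell of the bottom row of gamma lies in gamma / rho. *)
Definition bottom_right_new (rho gamma : seq nat) : bool :=
  (0, (head 0 gamma).-1) \in skew_cells gamma rho.

(* (k + la_1, la) / nu is a bottom strong l-strip; ch is nu^1, ..., nu^{k-l}. *)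
Definition bottom_strong_strip (k l : nat) (la nu : seq nat) : Prop :=
  [/\ 0 < l <= k, is_core k la, is_core k nu,
      horizontal_strip (add_row k la) nu
    & exists ch : seq (seq nat),
        [/\ size ch = k - l, last nu ch = add_row k la
          & path (fun rho gamma =>
                    strong_cover k rho gamma && bottom_right_new rho gamma)
                 nu ch]].

(* A filling is given by its rows, bottom row first. *)
Definition entry (T : seq (seq nat)) (c : nat * nat) : nat :=
  nth 0 (nth [::] T c.1) c.2.

Definition num_residues (k : nat) (nu : seq nat) (T : seq (seq nat)) (i : nat)
    : nat :=
  size (undup [seq residue k c | c <- cells nu & entry T c == i]).

Definition is_ktableau (k : nat) (nu : seq nat) (a : seq nat)
    (T : seq (seq nat)) : Prop :=
  [/\ (0 \notin a) && (sumn a == deg k nu),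
      shape T = nu /\ all (all (fun e => 0 < e <= size a)) T,
      all (sorted leq) T,
      (forall i j, (i.+1, j) \in cells nu -> entry T (i, j) < entry T (i.+1, j))
    & forall i, 0 < i <= size a -> num_residues k nu T i = nth 0 a i.-1].

(* Arrays are given by their rows, top row first; None is an empty cell. *)
Definition array := seq (seq (option nat)).

(* Row i of an array, rows being numbered from 1. *)
Definition arow (A : array) (i : nat) : seq (option nat) := nth [::] A i.-1.

Definition counter_row (row : seq (option nat)) : Prop :=
  exists m s, row = nseq m None ++ [seq Some e | e <- s] /\ sorted geq s.

(* The last field makes a counter-tableau with r rows have letters in 1, ..., r:
   an entry larger than r would be counted as empty in every shape below, so
   that lambda^(r) would not be the shape of the empty cells. *)
Definition is_counter_tableau (A : array) : Prop :=
  [/\ (forall i, 0 < i <= size A -> counter_row (arow A i)),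
      (forall i i' j e e', 0 < i -> i < i' ->
         nth None (arow A i) j = Some e -> nth None (arow A i') j = Some e' ->
         e < e')
    & forall i e, 0 < i <= size A -> Some e \in arow A i -> 0 < e <= size A].

Definition trim (s : seq nat) : seq nat :=
  foldr (fun x t => if (x == 0) && nilp t then [::] else x :: t) [::] s.

(* The shape lambda^(x). Some of its x parts may be 0, and partitions are only
   considered up to trailing zeros. *)
Definition inner (A : array) (x : nat) : seq nat :=
  trim [seq count (fun c => if c is Some e then x < e else true) row
       | row <- rev (take x A)].

Definition is_ABC (k : nat) (a : seq nat) (A : array) : Prop :=
  [/\ all (fun l => 0 < l <= k) a,
      size A = size a,
      is_counter_tableau A
    & forall i, 0 < i <= size a ->
      [/\ is_core k (inner A i.-1) && is_core k (inner A i),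
          size (arow A i) = k + head 0 (inner A i.-1),
          (forall e, Some e \in arow A i -> i <= e)
        & bottom_strong_strip k (nth 0 a i.-1) (inner A i.-1) (inner A i)]].

(* Objects are paired with their weights, which they determine (ktableau_weight
   and ABC_weight below). *)
Definition ktableaux (k : nat) (nu : seq nat) : set (seq (seq nat) * seq nat) :=
  [set p | is_ktableau k nu p.2 p.1].

Definition ABCs (k : nat) (la : seq nat) : set (array * seq nat) :=
  [set p | is_ABC k p.2 p.1 /\ inner p.1 (size p.1) = la].

(* Integer polynomials in the variables x_0, x_1, x_2, ...; x_0 is not used. *)
Definition xvar (i : nat) : {malg int[{cmonom nat}]} := << ucm i >>%R.

Definition xpow (a : seq nat) : {malg int[{cmonom nat}]} :=
  (\prod_(i < size a) xvar i.+1 ^+ nth 0%N a i)%R.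

(* The index set is finite (finite_ktableaux below), so this is a true sum. *)
Definition dual_kschur (k : nat) (nu : seq nat) : {malg int[{cmonom nat}]} :=
  (\sum_(p \in ktableaux k nu) xpow p.2)%R.

Lemma entry_le (T : seq (seq nat)) n c :
  all (all (fun e => 0 < e <= n)) T -> entry T c <= n.
Proof.
move=> /allP aT; rewrite /entry.
case: (ltnP c.1 (size T)) => [lt1|ge1]; last first.
  by rewrite (nth_default [::] ge1) nth_nil.
have /allP aR := aT _ (mem_nth [::] lt1).
case: (ltnP c.2 (size (nth [::] T c.1))) => [lt2|ge2]; last first.
  by rewrite (nth_default 0 ge2).
by have /andP[] := aR _ (mem_nth 0 lt2).
Qed.

Lemma num_residues_gt k nu T n i :
  all (all (fun e => 0 < e <= n)) T -> n < i -> num_residues k nu T i = 0.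
Proof.
move=> aT lt_ni; rewrite /num_residues.
suff -> : [seq c <- cells nu | entry T c == i] = [::] by [].
apply/eqP; rewrite -[_ == _]negbK -has_filter; apply/hasPn => c _.
by rewrite neq_ltn (leq_ltn_trans (entry_le c aT) lt_ni).
Qed.

Lemma ktableau_size k nu a b T :
  is_ktableau k nu a T -> is_ktableau k nu b T -> size a <= size b.
Proof.
move=> [/andP[a0 _] _ _ _ wa] [_ [_ bT] _ _ _].
rewrite leqNgt; apply/negP => lt_ba.
have sa : 0 < size a <= size a by rewrite leqnn (leq_ltn_trans _ lt_ba).
have := wa _ sa; rewrite (num_residues_gt _ _ bT lt_ba) => e.
case/negP: a0; rewrite e; apply: mem_nth.
by rewrite prednK //; case/andP: sa.
Qed.

Lemma ktableau_weight k nu a b T :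
  is_ktableau k nu a T -> is_ktableau k nu b T -> a = b.
Proof.
move=> Ta Tb; have eq_sz : size a = size b.
  by apply/eqP; rewrite eqn_leq !(ktableau_size Ta Tb, ktableau_size Tb Ta).
apply: (eq_from_nth (x0 := 0) eq_sz) => i lt_i.
case: Ta Tb => [_ _ _ _ wa] [_ _ _ _ wb].
by rewrite -(wa i.+1) // -(wb i.+1) // -eq_sz.
Qed.

Lemma strong_chain_deg k nu ch :
  path (fun rho gamma => strong_cover k rho gamma && bottom_right_new rho gamma)
    nu ch ->
  deg k (last nu ch) = deg k nu + size ch.
Proof.
elim: ch nu => [|ga ch IHch] nu /=; first by rewrite addn0.
case/andP=> /andP[/and4P[_ _ _ /eqP dga] _] /IHch->.
by rewrite dga addSnnS.
Qed.

Lemma bottom_strong_strip_inj k l l' la nu :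
  bottom_strong_strip k l la nu -> bottom_strong_strip k l' la nu -> l = l'.
Proof.
move=> [/andP[_ le_l] _ _ _ [ch [sz lst /strong_chain_deg]]].
move=> Hd [/andP[_ le_l'] _ _ _ [ch' [sz' lst' /strong_chain_deg]]].
move: Hd; rewrite lst lst' sz sz' => -> /addnI e.
by rewrite -(subKn le_l) e subKn.
Qed.

Lemma ABC_weight k a b A : is_ABC k a A -> is_ABC k b A -> a = b.
Proof.
move=> [_ sa _ wa] [_ sb _ wb].
have eq_sz : size a = size b by rewrite -sa sb.
apply: (eq_from_nth (x0 := 0) eq_sz) => i lt_i.
have [_ _ _ ha] := wa i.+1 lt_i; rewrite eq_sz in lt_i.
have [_ _ _ hb] := wb i.+1 lt_i.
exact: (bottom_strong_strip_inj ha hb).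
Qed.

Local Open Scope classical_set_scope.

Lemma finite_seqs (T : Type) (B : set T) n :
  finite_set B ->
  finite_set [set s : seq T | size s <= n /\ forall i x0, i < size s ->
                                              B (nth x0 s i)].
Proof.
move=> finB; elim: n => [|n IHn].
  apply: (@sub_finite_set _ _ [set [::]]) => [s [] /=|]; last exact: finite_set1.
  by case: s.
apply: (@sub_finite_set _ _
  ([set [::]] `|` [set x :: s | x in B & s in [set s : seq T | size s <= n /\
     forall i x0, i < size s -> B (nth x0 s i)]])); last first.
  by rewrite finite_setU; split; [exact: finite_set1|exact: finite_image2].
case=> [|x s] [/= sz Bs]; [by left|right].
exists x; first exact: (Bs 0 x).
by exists s => //; split=> // i x0 lt_i; exact: (Bs i.+1 x0).
Qed.

Lemma finite_ktableaux k nu : finite_set (ktableaux k nu).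
Proof.
pose d := deg k nu; pose m := size nu + \max_(x <- nu) x.
pose R n N := [set s : seq nat | size s <= n /\
  forall i x0, i < size s -> [set e | e <= N] (nth x0 s i)].
have finR n N : finite_set (R n N).
  apply: finite_seqs; apply: (@sub_finite_set _ _ `I_N.+1); last first.
    exact: finite_II.
  by move=> e.
apply: (@sub_finite_set _ _ ([set T : seq (seq nat) | size T <= m /\
    forall i x0, i < size T -> R m d (nth x0 T i)] `*` R d d)); last first.
  by apply: finite_setX; [apply: finite_seqs|].
case=> T a [/= /andP[a0 /eqP suma] [shT aT] _ _ _].
have lea e : e \in a -> e <= d.
  move=> ea; rewrite /d -suma sumnE.
  by rewrite (big_rem e) //= leq_addr.
have sza : size a <= d.
  rewrite /d -suma; elim: a a0 {suma aT lea} => //= x a IHa.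
  rewrite inE negb_or => /andP[x0 /IHa le]; rewrite -add1n.
  by apply: leq_add => //; rewrite lt0n eq_sym.
split; split=> /=.
- by rewrite -(size_map size T) -/(shape T) shT leq_addr.
- move=> i x0 lt_i; have Ti := mem_nth x0 lt_i; split.
    have : size (nth x0 T i) \in nu by rewrite -shT; apply: map_f.
    move=> sz_in; apply: leq_trans (leq_addl (size nu) _).
    exact: (@leq_bigmax_seq _ nu predT id).
  move=> j y0 lt_j /=; have /allP/(_ _ (mem_nth y0 lt_j)) := allP aT _ Ti.
  by case/andP=> _ le; apply: leq_trans le sza.
- exact: sza.
- by move=> i x0 lt_i; apply: lea; apply: mem_nth.
Qed.

(* Main.v *)
(** Both sides enumerate chains of (k+1)-cores from the empty core to [la] whose
    consecutive quotients are weak strips: horizontal strips whose number of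
    residues equals the increase of the degree.

    A core is described by its beads [la_i - i], a set closed under subtracting
    k+1.  Adding (removing) all cells of one residue preserves cores, changes the
    degree by at most one, and the two operations are adjoint for inclusion.  It
    follows that the degree is strictly monotone on cores, that what remains of a
    core after removing a horizontal strip with s residues contains a core whose
    degree is smaller by at most min(s, k), and dually for adding a strip.  In a
    tableau whose weight sums to the degree of its shape all these bounds are
    equalities, so all intermediate shapes are cores.

    A weak strip nu/la of size l is the same as a bottom strong l-strip
    (k + la_1, la)/nu.  Given the strong chain, the ends of the bottom rows of its
    k-l+1 members are pairwise incongruent and miss the residues of nu/la, so
    nu/la has at most l residues.  Conversely, the residues missing from nu/la, in
    the order of the bottom row, can be added one at a time to those acting on la,
    and each of them lengthens the bottom row. *)
Require Import Defs.
From mathcomp Require Import all_boot all_order all_algebra.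
From mathcomp Require Import boolp classical_sets functions cardinality fsbigop.
From mathcomp.multinomials Require Import monalg.
From mathcomp Require Import zify.

Set Implicit Arguments.
Unset Strict Implicit.
Unset Printing Implicit Defensive.

Import GRing.Theory Num.Theory.

(** * Partitions, hooks and beads *)

Lemma nth_trim s i : nth 0 (trim s) i = nth 0 s i.
Proof.
elim: s i => //= x s IHs i; case: ifP => [/andP[/eqP-> /nilP t0]|_].
  by case: i => [|i] //=; rewrite -IHs t0 !nth_nil.
by case: i => [|i] //=.
Qed.

Lemma size_trim s : size (trim s) <= size s.
Proof. by elim: s => //= x s IHs; case: ifP. Qed.

Lemma part_anti la i j : is_part la -> i <= j -> nth 0 la j <= nth 0 la i.
Proof.
case/andP=> srt _ le_ij; case: (ltnP j (size la)) => [lt|ge].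
  apply: (sorted_leq_nth (leT := geq)) => //.
  - by move=> x y z /= xy yz; apply: leq_trans yz xy.
  - by move=> x /=.
  - by rewrite inE (leq_ltn_trans le_ij).
by rewrite (nth_default _ ge).
Qed.

Lemma nth_part_gt0 la i : is_part la -> (0 < nth 0 la i) = (i < size la).
Proof.
case/andP=> _ nz; case: (ltnP i (size la)) => [lt|ge].
  by rewrite lt0n; apply: contraNneq nz => <-; apply: mem_nth.
by rewrite (nth_default _ ge).
Qed.

Lemma part_ext la mu : is_part la -> is_part mu ->
  (forall i, nth 0 la i = nth 0 mu i) -> la = mu.
Proof.
move=> pl pm e; apply: (@eq_from_nth _ 0) => [|i _]; last exact: e.
apply/eqP; rewrite eqn_leq; apply/andP; split; rewrite leqNgt; apply/negP.
  by move=> h; have := nth_part_gt0 (size mu) pl; rewrite h e nth_default.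
by move=> h; have := nth_part_gt0 (size la) pm; rewrite h -e nth_default.
Qed.

Lemma trim_part s : (forall i, nth 0 s i.+1 <= nth 0 s i) -> is_part (trim s).
Proof.
elim: s => [|x s IHs] //= mono.
have := IHs (fun i => mono i.+1).
case: ifPn => // nz /andP[srt nz0]; rewrite /is_part /=.
have hx : head 0 (trim s) <= x.
  by rewrite -nth0 nth_trim; have := mono 0.
apply/andP; split.
  by case: (trim s) srt hx => //= y t -> ->.
rewrite inE negb_or nz0 andbT; apply: contraNneq nz => x0.
rewrite -x0 eqxx /=; rewrite -x0 in hx.
by case: (trim s) nz0 hx => //= y t; rewrite inE leqn0 eq_sym => /norP[/negPf->].
Qed.

Lemma mem_cells la i j : ((i, j) \in cells la) = (j < nth 0 la i).
Proof.
apply/allpairsPdep/idP => [[x [y [hx hy [-> ->]]]]|lt].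
  by move: hy; rewrite mem_iota.
exists i, j; rewrite !mem_iota /= add0n; split=> //.
by rewrite ltnNge; apply: contraTN lt => ge; rewrite nth_default.
Qed.

Lemma uniq_cells la : uniq (cells la).
Proof.
apply: allpairs_uniq_dep => //.
- exact: iota_uniq.
- by move=> *; apply: iota_uniq.
- by move=> [x y] [x' y'] _ _ /= [-> ->].
Qed.

Lemma includedP mu la :
  reflect (forall i, nth 0 mu i <= nth 0 la i) (included mu la).
Proof.
apply: (iffP allP) => [h i|h [i j]]; last first.
  by rewrite !mem_cells => /leq_trans; apply.
rewrite leqNgt; apply/negP => lt; have := h (i, nth 0 la i).
by rewrite !mem_cells ltnn lt => /(_ isT).
Qed.

Lemma mem_skew la mu i j :
  ((i, j) \in skew_cells la mu) = (nth 0 mu i <= j < nth 0 la i).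
Proof. by rewrite mem_filter !mem_cells -leqNgt. Qed.

Definition hstrip (la mu : seq nat) : Prop :=
  forall i, nth 0 mu i <= nth 0 la i /\ nth 0 la i.+1 <= nth 0 mu i.

Lemma uniq_map_inj_in (T T' : eqType) (f : T -> T') (s : seq T) :
  uniq (map f s) -> {in s &, injective f}.
Proof.
move=> un x y xs ys e; rewrite -[LHS](nth_index x xs) -[RHS](nth_index x ys).
congr nth; apply/eqP.
rewrite -(nth_uniq (f x) (s := map f s)) ?size_map ?index_mem //.
by rewrite !(nth_map x) ?index_mem // !nth_index // e.
Qed.

Lemma hstripP la mu : is_part la -> is_part mu ->
  reflect (hstrip la mu) (horizontal_strip la mu).
Proof.
move=> pl pm; apply: (iffP andP) => [[/includedP inc un] i|h].
  split; first exact: inc.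
  rewrite leqNgt; apply/negP => lt.
  have m1 : (i, nth 0 mu i) \in skew_cells la mu.
    rewrite mem_skew leqnn /=; apply: leq_trans lt _; exact: part_anti.
  have m2 : (i.+1, nth 0 mu i) \in skew_cells la mu.
    by rewrite mem_skew lt part_anti.
  have : (i, nth 0 mu i) = (i.+1, nth 0 mu i).
    exact: (uniq_map_inj_in un).
  by case; lia.
split; first by apply/includedP => i; case: (h i).
rewrite map_inj_in_uniq ?filter_uniq ?uniq_cells //.
move=> [i j] [i' j'] /=; rewrite !mem_skew => h1 h2 /= ejj; subst j'.
suff: i = i' by move->.
wlog lt : i i' h1 h2 / i < i'.
  by move=> W; case: (ltngtP i i') => // lt; [|symmetry]; apply: W.
case: (h i) => _; have := @part_anti la i.+1 i' pl lt; lia.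
Qed.

(** Row lengths decrease, so the rows reaching past column [j] form an initial segment. This trades
    column heights for row lengths. *)
Lemma col_heightP la m j : is_part la ->
  (m < col_height la j) = (j < nth 0 la m).
Proof.
rewrite /col_height => /andP[srt _]; elim: la srt m => [|x la IHla] //= srt m.
  by rewrite nth_nil.
have srt' : sorted geq la by apply: path_sorted srt.
have lex : all (geq x) la.
  by apply: order_path_min srt => a b c /= ab bc; apply: leq_trans bc ab.
case: (ltnP j x) => hjx.
  by case: m => [|m] //=; rewrite add1n ltnS IHla.
have -> : count (ltn j) la = 0.
  apply/eqP; rewrite -leqn0 leqNgt -has_count -all_predC.
  by apply: sub_all lex => y /= yx; rewrite -leqNgt (leq_trans yx).
symmetry; rewrite addn0 ltn0; apply/negbTE; rewrite -leqNgt.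
case: m => [|m] //=; case: (ltnP m (size la)) => [lt|ge].
  by apply: leq_trans hjx; have /allP := lex; apply; apply: mem_nth.
by rewrite (nth_default _ ge).
Qed.

(** The Maya diagram of the partition. Rows past the last one have length 0 by the default of [nth],
    so all integers far enough to the left are beads. *)
Definition bead (la : seq nat) (x : int) : Prop :=
  exists i : nat, (x + i%:Z = (nth 0%N la i)%:Z)%R.

(** A bounded down-closed set of naturals is an initial segment, so its size is its threshold. The
    lemma serves for beads, for the shapes of a chain containing a cell and for rows of an array. *)
Lemma count_downclosed (p : pred nat) M :
  (forall i j, i <= j -> p j -> p i) -> (forall m, p m -> m < M) ->
  forall m, p m = (m < count p (iota 0 M)).
Proof.
move=> dc bd.
have H N m : m < N -> p m = (m < count p (iota 0 N)).
  elim: N m => // N IHN m; rewrite ltnS -[N.+1]addn1 iotaD count_cat /= addn0 add0n.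
  case pN: (p N) => mN.
    have -> : count p (iota 0 N) = N.
      apply/eqP; rewrite -[X in _ == X](size_iota 0) -all_count; apply/allP => x.
      by rewrite mem_iota /= => /ltnW/dc; apply.
    by rewrite addn1 ltnS mN; apply: dc pN.
  rewrite addn0; move: mN; rewrite leq_eqVlt => /predU1P[->|/IHN//].
  rewrite pN; symmetry; apply/negbTE; rewrite -leqNgt.
  by rewrite -[X in _ <= X](size_iota 0 N) count_size.
move=> m; case: (ltnP m M) => [|le]; first exact: H.
have -> : p m = false by apply/negP => /bd; rewrite ltnNge le.
symmetry; apply/negbTE; rewrite -leqNgt; apply: leq_trans le.
by rewrite -[X in _ <= X](size_iota 0 M) count_size.
Qed.

(* The number of beads of [la] to the right of the position [n] steps to the left
   of the bead of row [i]. *)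
Definition nbeads n la M i : nat :=
  count (fun m => nth 0 la i + m < nth 0 la m + i + n) (iota 0 M).

Lemma nbeadsP n la M i m : is_part la -> n + i <= M ->
  (nth 0 la i + m < nth 0 la m + i + n) = (m < nbeads n la M i).
Proof.
move=> pl hM; rewrite /nbeads.
rewrite (@count_downclosed (fun m => nth 0 la i + m < nth 0 la m + i + n) M) //.
- by move=> a b ab; have := part_anti pl ab; lia.
- move=> a ha; apply: leq_trans hM; rewrite ltnNge; apply/negP => le.
  have := @part_anti la i a pl; lia.
Qed.

Lemma nbeads_bounds n la M i : is_part la -> n + i <= M ->
  nbeads n la M i <= n + i <= nbeads n la M i + nth 0 la i.
Proof.
move=> pl hM; apply/andP; split; rewrite leqNgt; apply/negP.
  rewrite -nbeadsP // => h.
  have := @part_anti la i (n + i) pl; lia.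
have H := nbeadsP (nbeads n la M i) pl hM.
rewrite ltnn in H; lia.
Qed.

(** Hook lengths in row [i] are the distances from its bead to the gaps on its left. Of these gaps,
    [n + i - nbeads n la M i] are closer than [n], and they belong to the last cells of the row. *)
Lemma hook_geE n la M i j : is_part la -> n + i <= M -> j < nth 0 la i ->
  (n <= hook la (i, j)) = (n + i + j < nbeads n la M i + nth 0 la i).
Proof.
move=> pl hM hj; rewrite /hook /=.
have hc : i < col_height la j by rewrite col_heightP.
case: (ltnP (n + i + j) (nth 0 la i)) => h; first lia.
have := nbeadsP (n + i + j - nth 0 la i) pl hM.
have := col_heightP (n + i + j - nth 0 la i) j pl.
lia.
Qed.

(** By the same correspondence, a hook of length [k.+1] is a gap [k.+1] steps to the left of a
    bead. *)
Lemma core_hookP k la : is_part la ->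
  reflect (forall i, bead la ((nth 0%N la i)%:Z - i%:Z - k.+1%:Z)%R) (is_core k la).
Proof.
move=> pl; rewrite /is_core pl /=; apply: (iffP allP) => H.
  move=> i; pose M := k.+1 + i; pose N := nbeads k.+1 la M i.
  have B := @nbeads_bounds k.+1 la M i pl (leqnn _); rewrite -/N in B.
  have PN m := @nbeadsP k.+1 la M i m pl (leqnn _); rewrite -/N in PN.
  (* Row [N] is the first whose bead is not to the right of the wanted position, hence the only
     candidate. *)
  exists N; have := PN N; rewrite ltnn => hN.
  case: (ltnP (nth 0 la N + i + k.+1) (nth 0 la i + N)) => [lt|]; last lia.
  exfalso; have hj : nth 0 la N + i + k.+1 <= nth 0 la i + N.-1 by lia.
  (* If the position is a gap, this column has height [N], and its cell in row [i] has hook length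
     [k.+1]. *)
  have [j hj2] : exists j, j + i + k.+1 = nth 0 la i + N.-1.
    by exists (nth 0 la i + N.-1 - i - k.+1); lia.
  have N0 : 0 < N.
    rewrite lt0n; apply/negP => /eqP N0; have := PN i; rewrite N0 ltn0; lia.
  have h1 := PN N.-1.
  have ji : j < nth 0 la i by lia.
  have := H (i, j); rewrite mem_cells ji => /(_ isT) /eqP; apply.
  have c1 := col_heightP N.-1 j pl.
  have c2 := col_heightP N j pl.
  have c3 := col_heightP i j pl.
  rewrite /hook /=; lia.
move=> [i j]; rewrite mem_cells => hj; apply/eqP => e.
have [m hm] := H i.
have c3 := col_heightP i j pl.
have c := col_heightP m j pl.
move: e; rewrite /hook /=; lia.
Qed.

Lemma row_deg k la M i : is_part la -> k.+1 + i <= M ->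
  count (fun j => hook la (i, j) < k.+1) (iota 0 (nth 0 la i))
    + nbeads k.+1 la M i = k.+1 + i.
Proof.
move=> pl hM; have := nbeads_bounds pl hM; set N := nbeads _ _ _ _ => B.
(* The first [d] cells of the row are those with hook length at least [k.+1]. *)
have [d hd] : exists d, d + (k.+1 + i) = N + nth 0 la i.
  by exists (N + nth 0 la i - (k.+1 + i)); lia.
have dle : d <= nth 0 la i by lia.
have -> : count (fun j => hook la (i, j) < k.+1) (iota 0 (nth 0 la i)) =
          count (fun j => d <= j) (iota 0 (nth 0 la i)).
  apply: eq_in_count => j; rewrite mem_iota /= add0n => hj.
  rewrite ltnNge (hook_geE pl hM hj) -/N; lia.
rewrite -{1}(subnKC dle) iotaD count_cat add0n.
have -> : count (fun j => d <= j) (iota 0 d) = 0.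
  apply/eqP; rewrite -leqn0 leqNgt -has_count; apply/hasPn => x.
  by rewrite mem_iota /= -ltnNge.
have -> : count (fun j => d <= j) (iota d (nth 0 la i - d)) = nth 0 la i - d.
  apply/eqP; rewrite -[X in _ == X](size_iota d) -all_count; apply/allP => x.
  by rewrite mem_iota => /andP[].
lia.
Qed.

Lemma deg_rows k la :
  deg k la =
  \sum_(0 <= i < size la) count (fun j => hook la (i, j) < k.+1)
                                (iota 0 (nth 0 la i)).
Proof.
rewrite /deg /cells count_flatten sumnE !big_map -/(index_iota 0 (size la)).
rewrite /index_iota subn0; apply: eq_bigr => i _.
by rewrite count_map; apply: eq_count.
Qed.

(** The right-hand side does not depend on [la], so changes of degree can be read off from bead
    counts. As [L] may exceed the number of rows, two cores can share the same [L]. *)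
Lemma deg_nbeads k la L M : is_part la -> size la <= L -> k.+1 + L <= M ->
  deg k la + \sum_(0 <= i < L) nbeads k.+1 la M i = \sum_(0 <= i < L) (k.+1 + i).
Proof.
move=> pl hL hM.
have -> : deg k la = \sum_(0 <= i < L) count (fun j => hook la (i, j) < k.+1)
                                (iota 0 (nth 0 la i)).
  rewrite deg_rows (big_cat_nat (leq0n _) hL) //= [X in _ = _ + X]big1_seq ?addn0 //.
  by move=> i; rewrite mem_index_iota => /= /andP[hi _]; rewrite nth_default.
rewrite -big_split /=; apply: eq_big_seq => i; rewrite mem_index_iota => /andP[_ hi].
apply: row_deg => //; lia.
Qed.

(** * Adding and removing all cells of one residue *)

Lemma modz_eq_ex (n : nat) (x y : int) :
  (x %% n = y %% n)%Z -> exists q : int, (x = y + q * n%:Z)%R.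
Proof.
move=> e; exists ((x %/ n)%Z - (y %/ n)%Z)%R.
by rewrite {1}(divz_eq x n) {1}(divz_eq y n) e mulrBl; lia.
Qed.

Lemma modz_close (n : nat) (x y : int) :
  (x %% n = y %% n)%Z -> (x < y + n%:Z)%R -> (y < x + n%:Z)%R -> x = y.
Proof. by case/modz_eq_ex => q -> h1 h2; rewrite (_ : q = 0%R) ?mul0r ?addr0 //; nia. Qed.

Lemma modz_shift (n : nat) (x y z : int) :
  (x %% n = y %% n)%Z -> ((x + z) %% n = (y + z) %% n)%Z.
Proof. by move=> e; rewrite -modzDml e modzDml. Qed.

Definition rowend (la : seq nat) (i : nat) : int := ((nth 0%N la i)%:Z - i%:Z)%R.

Lemma bead_row la i : bead la (rowend la i).
Proof. by exists i; rewrite /rowend; lia. Qed.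

(** The next cell of row [i] has content [rowend la i]. In terms of beads, the bead of row [i] is
    free to move one step to the right. *)
Definition addable k (r : int) la i : bool :=
  ((rowend la i %% k.+1)%Z == r) && ((i == 0) || (nth 0 la i < nth 0 la i.-1)).

Definition removable k (r : int) la i : bool :=
  (((rowend la i - 1)%R %% k.+1)%Z == r) && (nth 0 la i.+1 < nth 0 la i).

(** The range has one row more than [la], since a cell may start a new row. *)
Definition res_add k r la : seq nat :=
  trim (mkseq (fun i => nth 0 la i + addable k r la i) (size la).+1).

Definition res_del k r la : seq nat :=
  trim (mkseq (fun i => nth 0 la i - removable k r la i) (size la)).

Lemma addable_le_size k r la i : is_part la -> addable k r la i -> i <= size la.
Proof.
move=> pl /andP[_ /orP[/eqP->//|lt]].
by case: i lt => // i /= lt; rewrite -(nth_part_gt0 i pl); lia.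
Qed.

Lemma nth_res_add k r la i : is_part la ->
  nth 0 (res_add k r la) i = nth 0 la i + addable k r la i.
Proof.
move=> pl; rewrite nth_trim; case: (ltnP i (size la).+1) => h.
  by rewrite nth_mkseq.
rewrite !nth_default ?size_mkseq //; last lia.
by case: (boolP (addable _ _ _ _)) => // /(addable_le_size pl); lia.
Qed.

Lemma nth_res_del k r la i :
  nth 0 (res_del k r la) i = nth 0 la i - removable k r la i.
Proof.
rewrite nth_trim; case: (ltnP i (size la)) => h; first by rewrite nth_mkseq.
by rewrite !nth_default ?size_mkseq.
Qed.

Lemma res_add_part k r la : is_part la -> is_part (res_add k r la).
Proof.
move=> pl; apply: trim_part => i;
  rewrite -[leqLHS]nth_trim -[leqRHS]nth_trim -/(res_add k r la).
rewrite !nth_res_add //; have := part_anti pl (leqnSn i).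
by rewrite /addable /=; lia.
Qed.

Lemma res_del_part k r la : is_part la -> is_part (res_del k r la).
Proof.
move=> pl; apply: trim_part => i;
  rewrite -[leqLHS]nth_trim -[leqRHS]nth_trim -/(res_del k r la).
rewrite !nth_res_del; have := part_anti pl (leqnSn i).
by rewrite /removable; lia.
Qed.

Lemma bead_uniq la x i j : is_part la ->
  (x + i%:Z = (nth 0%N la i)%:Z)%R -> (x + j%:Z = (nth 0%N la j)%:Z)%R -> i = j.
Proof.
move=> pl; wlog lt : i j / i < j.
  by move=> W hi hj; case: (ltngtP i j) => // lt; [|symmetry]; apply: W.
by have := part_anti pl (ltnW lt); lia.
Qed.

Lemma gap_addable k r la i : is_part la -> addable k r la i ->
  ~ bead la (rowend la i + 1)%R.
Proof.
move=> pl /andP[_ h] [m]; rewrite /rowend => hm.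
case: (leqP i m) => hmi; first by have := part_anti pl hmi; lia.
by case: i h hm hmi => // i /= h hm hmi; have := @part_anti la m i pl; lia.
Qed.

Lemma bead_not_addable k r la i : is_part la -> (rowend la i %% k.+1)%Z = r ->
  ~~ addable k r la i -> bead la (rowend la i + 1)%R.
Proof.
move=> pl e; rewrite /addable e eqxx /= negb_or => /andP[i0 h].
exists i.-1; rewrite /rowend; have := @part_anti la i.-1 i pl; lia.
Qed.

Lemma gap_removable k r la i : is_part la -> removable k r la i ->
  ~ bead la (rowend la i - 1)%R.
Proof.
move=> pl /andP[_ h] [m]; rewrite /rowend => hm.
case: (leqP m i) => hmi; first by have := part_anti pl hmi; lia.
by have := part_anti pl hmi; lia.
Qed.

Lemma not_removable k r la i : is_part la ->
  ((rowend la i - 1)%R %% k.+1)%Z = r -> ~~ removable k r la i ->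
  rowend la i.+1 = (rowend la i - 1)%R.
Proof.
move=> pl e; rewrite /removable e eqxx /= /rowend => h.
by have := part_anti pl (leqnSn i); lia.
Qed.

Lemma core_part k la : is_core k la -> is_part la.
Proof. by case/andP. Qed.

Lemma core_bead k la x : is_core k la -> bead la x -> bead la (x - k.+1%:Z)%R.
Proof.
move=> cl [i hi]; have /(core_hookP k (core_part cl))/(_ i) := cl.
by have -> : ((nth 0%N la i)%:Z - i%:Z = x)%R by lia.
Qed.

Lemma beads_core k la : is_part la ->
  (forall i, bead la (rowend la i - k.+1%:Z)%R) -> is_core k la.
Proof. by move=> pl h; apply/core_hookP. Qed.

Lemma core_bead_down k la x y : is_core k la -> bead la x ->
  (x %% k.+1 = y %% k.+1)%Z -> (y <= x)%R -> bead la y.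
Proof.
move=> cl bx /modz_eq_ex [q e] le.
have [m hm] : exists m : nat, (q = m%:Z)%R by exists `|q|%N; nia.
have -> : (y = x - m%:Z * k.+1%:Z)%R by rewrite e hm; lia.
elim: m {e hm le} => [|m IHm]; first by rewrite mul0r subr0.
by have := core_bead cl IHm; congr bead; lia.
Qed.

Lemma modz_succ_neq k (x : int) : 0 < k -> ((x + 1)%R %% k.+1)%Z <> (x %% k.+1)%Z.
Proof. by move=> hk e; have := modz_close e; lia. Qed.

Lemma rowend_res_add k r la i : is_part la ->
  rowend (res_add k r la) i = (rowend la i + (addable k r la i)%:Z)%R.
Proof. by move=> pl; rewrite /rowend nth_res_add //; lia. Qed.

Lemma rowend_res_del k r la i : is_part la ->
  rowend (res_del k r la) i = (rowend la i - (removable k r la i)%:Z)%R.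
Proof.
move=> pl; rewrite /rowend nth_res_del; case: (boolP (removable k r la i)) => /=; last lia.
by case/andP=> _; lia.
Qed.

Lemma beadP la x : bead la x <-> exists i, x = rowend la i.
Proof. by split=> -[i hi]; exists i; move: hi; rewrite /rowend; lia. Qed.

(** Compare the runners of residues [r] and [r + 1], distinct as [0 < k], by a shift of one step.
    Their bead sets become the intersection and the union of the two, which are still closed under
    subtracting [k.+1]. *)
Lemma res_add_core k r la : 0 < k -> is_core k la -> is_core k (res_add k r la).
Proof.
move=> hk cl; have pl := core_part cl; apply: beads_core => [|i].
  exact: res_add_part.
have Bd j : ~~ addable k r la j -> bead (res_add k r la) (rowend la j).
  by move=> nA; apply/beadP; exists j; rewrite rowend_res_add // (negbTE nA) addr0.
have Ba j : addable k r la j -> bead (res_add k r la) (rowend la j + 1)%R.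
  by move=> A; apply/beadP; exists j; rewrite rowend_res_add // A.
have [m hm] := (beadP _ _).1 (core_bead cl (bead_row la i)).
have em : (rowend la i %% k.+1 = rowend la m %% k.+1)%Z.
  by rewrite -hm -(modzMDl (-1)) mulN1r addrC.
rewrite rowend_res_add //; case: (boolP (addable k r la i)) => Ai /=.
  have {hm}-> : (rowend la i + 1 - k.+1%:Z = rowend la m + 1)%R by lia.
  case: (boolP (addable k r la m)) => Am; first exact: Ba.
  case/andP: Ai => /eqP ri _.
  have [j hj] := (beadP _ _).1 (bead_not_addable pl (etrans (esym em) ri) Am).
  rewrite hj; apply: Bd; apply/negP => /andP[/eqP rj _].
  by apply: (@modz_succ_neq k (rowend la m) hk); rewrite hj rj -em ri.
rewrite addr0 hm; case: (boolP (addable k r la m)) => Am; last exact: Bd.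
(* Here the bead of row [m] moves while that of row [i] is blocked by a bead on its right; closure
   then blocks row [m] as well. *)
have [/andP[/eqP rm _]] := (Am, gap_addable pl Am); case.
have := core_bead cl (bead_not_addable pl (etrans em rm) Ai).
by congr bead; lia.
Qed.

Lemma res_del_core k r la : 0 < k -> is_core k la -> is_core k (res_del k r la).
Proof.
move=> hk cl; have pl := core_part cl; apply: beads_core => [|i].
  exact: res_del_part.
have Bd j : ~~ removable k r la j -> bead (res_del k r la) (rowend la j).
  by move=> nA; apply/beadP; exists j; rewrite rowend_res_del // (negbTE nA) subr0.
have Ba j : removable k r la j -> bead (res_del k r la) (rowend la j - 1)%R.
  by move=> A; apply/beadP; exists j; rewrite rowend_res_del // A.
have [m hm] := (beadP _ _).1 (core_bead cl (bead_row la i)).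
have em : ((rowend la i - 1)%R %% k.+1 = (rowend la m - 1)%R %% k.+1)%Z.
  by rewrite -hm -(modzMDl (-1) (rowend la i - 1)); congr modz; lia.
rewrite rowend_res_del //; case: (boolP (removable k r la i)) => Ai /=.
  have {hm}-> : (rowend la i - 1 - k.+1%:Z = rowend la m - 1)%R by lia.
  case: (boolP (removable k r la m)) => Am; first exact: Ba.
  case/andP: Ai => /eqP ri _.
  have hj := not_removable pl (etrans (esym em) ri) Am.
  rewrite -hj; apply: Bd; apply/negP => /andP[/eqP rj _].
  apply: (@modz_succ_neq k (rowend la m.+1 - 1)%R hk); rewrite rj subrK hj -em.
  by [].
rewrite subr0 hm; case: (boolP (removable k r la m)) => Am; last exact: Bd.
have [/andP[/eqP rm _]] := (Am, gap_removable pl Am); case.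
have := core_bead cl (bead_row la i.+1); rewrite (not_removable pl (etrans em rm) Ai).
by congr bead; lia.
Qed.

(** Deletion is left adjoint to addition. Both sides say that a row of [nu] exceeds that of [mu] by
    at most one cell, of residue [r], which is removable from [nu] and equally addable to [mu]. *)
Lemma res_del_leP k r nu mu : is_part nu -> is_part mu ->
  (forall i, nth 0 (res_del k r nu) i <= nth 0 mu i) <->
  (forall i, nth 0 nu i <= nth 0 (res_add k r mu) i).
Proof.
move=> pn pm; split=> H i; have := H i; have := H i.+1; have := H i.-1;
  have := @part_anti nu i.-1 i pn; have := @part_anti nu i i.+1 pn;
  have := @part_anti mu i.-1 i pm; have := @part_anti mu i i.+1 pm;
  rewrite !nth_res_del !nth_res_add // leq_pred leqnSn => /(_ isT) A1 /(_ isT) A2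
   /(_ isT) A3 /(_ isT) A4 H1 H2 H3.
- case: (leqP (nth 0 nu i) (nth 0 mu i)) => [|lt]; first lia.
  have /andP[ri si] : removable k r nu i by move: H3; case: removable; lia.
  have em : nth 0 nu i = (nth 0 mu i).+1 by move: H3; case: removable => /=; lia.
  suff -> : addable k r mu i by lia.
  rewrite /addable; apply/andP; split.
    by rewrite -(eqP ri) /rowend em; apply/eqP; congr modz; lia.
  case: i H1 A1 A2 A3 A4 em si {H2 H3 lt ri} => [|i] //= H1 A1 A2 A3 A4 em si.
  by move: H1; rewrite /removable; lia.
- case: (leqP (nth 0 nu i) (nth 0 mu i)) => [|lt]; first lia.
  have /andP[ri si] : addable k r mu i by move: H3; case: addable; lia.
  have em : nth 0 nu i = (nth 0 mu i).+1 by move: H3; case: addable => /=; lia.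
  suff -> : removable k r nu i by lia.
  rewrite /removable; apply/andP; split.
    by rewrite -(eqP ri) /rowend em; apply/eqP; congr modz; lia.
  by move: H2; rewrite /addable /=; lia.
Qed.

(** * The degree of a core *)

Lemma count_split (T : Type) (a b c : pred T) s :
  (forall x, (a x : nat) = b x + c x) -> count a s = count b s + count c s.
Proof. by move=> h; elim: s => //= x s ->; rewrite h; lia. Qed.

(* Adding all cells of residue r moves every bead of an addable row one step to
   the right, so the counts in [nbeads] change by the number of pairs (i, m) with
   i addable and the bead of m exactly k steps to the left of that of i. *)
Lemma res_add_pairs k r la i m : 0 < k -> is_core k la ->
  let la' := res_add k r la in
  ((nth 0 la i + m < nth 0 la m + i + k.+1) : nat) =
  (nth 0 la' i + m < nth 0 la' m + i + k.+1) +
  (addable k r la i && (nth 0 la i + 1 + m == nth 0 la m + i + k.+1)).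
Proof.
move=> hk cl /=; have pl := core_part cl; rewrite !nth_res_add //.
case: (boolP (addable k r la i)) => Ai; case: (boolP (addable k r la m)) => Am /=.
- case/andP: Ai Am => /eqP ri _ /andP[/eqP rm _].
  have /modz_eq_ex [q] : (rowend la i %% k.+1 = rowend la m %% k.+1)%Z.
    by rewrite ri rm.
  rewrite /rowend => e; have : nth 0 la i + 1 + m <> nth 0 la m + i + k.+1.
    move=> e2; have h : (q * k.+1%:Z = k%:Z)%R; last by case: (lerP q 0%R); nia.
    by move: e; set z := (q * _)%R; lia.
  lia.
- lia.
- have : nth 0 la i + m <> nth 0 la m + i + k.+1; last lia.
  move=> e; have [/andP[/eqP rm _]] := (Am, gap_addable pl Am); case.
  have em : (rowend la i = rowend la m + k.+1%:Z)%R by rewrite /rowend; lia.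
  have ei : (rowend la i %% k.+1)%Z = r.
    by rewrite em -rm -(modzMDl 1 (rowend la m)); congr modz; lia.
  have := core_bead cl (bead_not_addable pl ei Ai); congr bead; lia.
- lia.
Qed.

(** Exactly one of the pairs of [res_add_pairs] occurs, and it comes from the leftmost bead that
    moves, in row [i0] below. So the bead counts drop by one in total. *)
Lemma deg_res_add k r la i : 0 < k -> is_core k la -> addable k r la i ->
  deg k (res_add k r la) = (deg k la).+1.
Proof.
move=> hk cl Ai; have pl := core_part cl.
have cl' := res_add_core r hk cl; have pl' := core_part cl'.
pose L := (size la).+1; pose M := k.+1 + L.
have sz' : size (res_add k r la) <= L.
  by apply: leq_trans (size_trim _) _; rewrite size_mkseq.
have D := @deg_nbeads k la L M pl (leqnSn _) (leqnn _).
have D' := @deg_nbeads k _ L M pl' sz' (leqnn _).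
pose e i := count (fun m => addable k r la i &&
                (nth 0 la i + 1 + m == nth 0 la m + i + k.+1)) (iota 0 M).
have N i1 : nbeads k.+1 la M i1 = nbeads k.+1 (res_add k r la) M i1 + e i1.
  by apply: count_split => m; apply: res_add_pairs.
suff E : \sum_(0 <= i < L) e i = 1.
  move: D; rewrite (eq_bigr _ (fun i1 _ => N i1)) big_split /= E; lia.
have [i0 A0 max0] : exists2 i0, addable k r la i0 &
    forall j, addable k r la j -> j <= i0.
  have [|i0 A0 mx] := @ex_maxnP (addable k r la) (size la) (ex_intro _ i Ai).
    by move=> j; apply: addable_le_size.
  by exists i0.
(* The bead [k.+1] steps to the left of that of [i0] belongs to a later row and does not move, so
   there is a bead just to its right. *)
have [m0 hm0] : bead la (rowend la i0 + 1 - k.+1%:Z)%R.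
  have [m hm] := (beadP _ _).1 (core_bead cl (bead_row la i0)).
  have em : (rowend la i0 %% k.+1 = rowend la m %% k.+1)%Z.
    by rewrite -hm -(modzMDl (-1)) mulN1r addrC.
  case: (boolP (addable k r la m)) => Am.
    have := max0 _ Am => lemi; have := part_anti pl lemi.
    by move: hm; rewrite /rowend; lia.
  case/andP: A0 => /eqP r0 _.
  have := bead_not_addable pl (etrans (esym em) r0) Am; congr bead; lia.
have lt0 : i0 < L by rewrite ltnS (addable_le_size pl A0).
have ltm : m0 < M.
  rewrite ltnNge; apply/negP => leM.
  have : nth 0 la m0 = 0 by rewrite nth_default //; move: leM; rewrite /M /L; lia.
  by move: hm0 leM; rewrite /rowend /M; lia.
have e0 : e i0 = 1.
  rewrite /e A0; transitivity (count (pred1 m0) (iota 0 M)); last first.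
    by rewrite (count_uniq_mem m0 (iota_uniq 0 M)) mem_iota ltm.
  apply: eq_in_count => m _ /=; apply/eqP/eqP => [e1|->]; last first.
    by move: hm0; rewrite /rowend; lia.
  by apply: (bead_uniq pl _ hm0); rewrite /rowend; lia.
rewrite (bigD1_seq i0) ?mem_index_iota ?iota_uniq //= e0.
rewrite big1 // => j nj; apply/eqP; rewrite -leqn0 leqNgt -has_count.
(* For another addable row [j], such a bead would by closure force one just to the right of the bead
   of [i0]. *)
apply/hasP => -[m _ /andP[Aj /eqP em]].
have lt : j < i0 by rewrite ltn_neqAle nj max0.
apply: (gap_addable pl A0).
case/andP: (A0) (Aj) => /eqP r0 _ /andP[/eqP rj _].
have ej : (rowend la j %% k.+1 = rowend la i0 %% k.+1)%Z by rewrite r0 rj.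
apply: (@core_bead_down k la (rowend la j + 1 - k.+1%:Z)%R _ cl).
- by exists m; rewrite /rowend; lia.
- rewrite -(modzMDl 1 (_ - _)) mul1r addrCA subrr addr0; exact: modz_shift.
case/modz_eq_ex: ej => q ej; have := part_anti pl (ltnW lt).
by move: ej; rewrite /rowend; case: (lerP q 0%R); nia.
Qed.

Lemma res_add_id k r la : is_part la -> (forall i, ~~ addable k r la i) ->
  res_add k r la = la.
Proof.
move=> pl nA; apply: part_ext => // [|i]; first exact: res_add_part.
by rewrite nth_res_add // (negbTE (nA i)) addn0.
Qed.

Lemma res_del_id k r la : is_part la -> (forall i, ~~ removable k r la i) ->
  res_del k r la = la.
Proof.
move=> pl nA; apply: part_ext => // [|i]; first exact: res_del_part.
by rewrite nth_res_del // (negbTE (nA i)) subn0.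
Qed.

Lemma deg_res_add_le k r la : 0 < k -> is_core k la ->
  deg k (res_add k r la) <= (deg k la).+1.
Proof.
move=> hk cl; have pl := core_part cl.
case: (boolP (has (addable k r la) (iota 0 (size la).+1))) => [/hasP[i _ Ai]|/hasPn h].
  by rewrite (deg_res_add hk cl Ai).
rewrite res_add_id // => i; apply/negP => Ai; have := addable_le_size pl Ai => le.
by have := h i; rewrite mem_iota Ai /= add0n ltnS => /(_ le).
Qed.

(** In a core, removable and addable rows of the same residue do not coexist. So the rows addable
    after the deletion are exactly those just shortened. *)
Lemma res_delK k r la i : 0 < k -> is_core k la -> removable k r la i ->
  res_add k r (res_del k r la) = la /\ addable k r (res_del k r la) i.
Proof.
move=> hk cl Ri; have pl := core_part cl; have pd := res_del_part k r pl.
have RA j : removable k r la j = addable k r (res_del k r la) j.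
  apply/idP/idP => [Rj|Aj].
    case/andP: (Rj) => /eqP rj lt; rewrite /addable rowend_res_del // Rj rj eqxx /=.
    case: j {rj} Rj lt => //= j Rj lt; rewrite !nth_res_del Rj.
    have := part_anti pl (leqnSn j).
    by case: (boolP (removable k r la j)) => [/andP[_]|_] /=; lia.
  (* Runner [r] would have a bead with a gap on its right (row [j]) and a gap with a bead on its
     right (row [i]). Closure fails on runner [r] or on runner [r + 1], depending on which is
     further left. *)
  apply/negPn/negP => nRj; have gap := gap_removable pl Ri.
  case/andP: Aj; rewrite rowend_res_del // (negbTE nRj) subr0 => /eqP rj h.
  have gj : ~ bead la (rowend la j + 1)%R.
    apply: (@gap_addable k r) => //; rewrite /addable rj eqxx /=.
    case: j h nRj {rj} => //= j + nR; rewrite !nth_res_del (negbTE nR); lia.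
  case/andP: Ri => /eqP ri _.
  have eij : (rowend la j %% k.+1 = (rowend la i - 1)%R %% k.+1)%Z by rewrite ri rj.
  case: (lerP (rowend la i - 1)%R (rowend la j)) => cmp.
    by apply: gap; apply: core_bead_down cl (bead_row la j) eij cmp.
  apply: gj; apply: core_bead_down cl (bead_row la i) _ _; last lia.
  by rewrite -[X in (X %% _)%Z](subrK 1%R); apply: modz_shift.
split; last by rewrite -RA.
apply: part_ext => // [|j]; first exact: res_add_part.
rewrite nth_res_add // -RA nth_res_del.
by case: (boolP (removable k r la j)) => /= [/andP[_]|_]; lia.
Qed.

Lemma deg_res_del k r la i : 0 < k -> is_core k la -> removable k r la i ->
  deg k la = (deg k (res_del k r la)).+1.
Proof.
move=> hk cl Ri; have [e Ai] := res_delK hk cl Ri.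
by rewrite -[in LHS]e (deg_res_add hk (res_del_core r hk cl) Ai).
Qed.

Lemma res_del_mono k r mu la : is_part mu -> is_part la -> included mu la ->
  included (res_del k r mu) (res_del k r la).
Proof.
move=> pm pl /includedP h; apply/includedP; apply/res_del_leP => //.
  exact: res_del_part.
have : forall i, nth 0 la i <= nth 0 (res_add k r (res_del k r la)) i.
  by apply/res_del_leP => //; apply: res_del_part.
by move=> h2 i; apply: leq_trans (h i) (h2 i).
Qed.

Lemma res_add_mono k r mu la : is_part mu -> is_part la -> included mu la ->
  included (res_add k r mu) (res_add k r la).
Proof.
move=> pm pl /includedP h; apply/includedP; apply/res_del_leP => //.
  exact: res_add_part.
have : forall i, nth 0 (res_del k r (res_add k r mu)) i <= nth 0 mu i.
  by apply/res_del_leP => //; apply: res_add_part.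
by move=> h2 i; apply: leq_trans (h2 i) (h i).
Qed.

Lemma included_anti mu la : is_part mu -> is_part la ->
  included mu la -> included la mu -> mu = la.
Proof.
move=> pm pl /includedP h1 /includedP h2; apply: part_ext => // i.
by apply/eqP; rewrite eqn_leq h1 h2.
Qed.

Lemma deg_res_del_le k r la : 0 < k -> is_core k la ->
  deg k la <= (deg k (res_del k r la)).+1.
Proof.
move=> hk cl; have pl := core_part cl.
case: (boolP (has (removable k r la) (iota 0 (size la)))) => [/hasP[i _ Ai]|/hasPn h].
  by rewrite (deg_res_del hk cl Ai).
rewrite res_del_id // => i; apply/negP => Ai; have := h i.
by rewrite mem_iota Ai -(nth_part_gt0 i pl); case/andP: Ai => _; lia.
Qed.

(** Induction on the degree of [ga]: delete from both cores the residue of the last cell of the top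
    row of [ga], whose degree drops by one. Either that of [rho] drops too and the cores stay
    distinct, or [rho] is unchanged and still included. *)
Lemma deg_lt k rho ga : 0 < k -> is_core k rho -> is_core k ga ->
  included rho ga -> rho <> ga -> deg k rho < deg k ga.
Proof.
move=> hk; have [n] := ubnP (deg k ga); elim: n rho ga => // n IHn rho ga.
rewrite ltnS => le_n cr cg inc ne; have [pr pg] := (core_part cr, core_part cg).
have sg : 0 < size ga.
  rewrite lt0n size_eq0; apply/eqP => g0; apply: ne; apply: included_anti => //.
  by rewrite g0; apply/includedP => i; rewrite nth_nil.
pose i := (size ga).-1; pose r := ((rowend ga i - 1)%R %% k.+1)%Z.
have Ri : removable k r ga i.
  rewrite /removable eqxx /= nth_default; last by rewrite /i prednK.
  by rewrite nth_part_gt0 // /i prednK.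
have dg := deg_res_del hk cg Ri; have [eg _] := res_delK hk cg Ri.
have cg' := res_del_core r hk cg; have cr' := res_del_core r hk cr.
have inc' := @res_del_mono k r _ _ pr pg inc.
case: (boolP (has (removable k r rho) (iota 0 (size rho)))) => [/hasP[j _ Rj]|/hasPn h].
  have [er _] := res_delK hk cr Rj.
  rewrite dg (deg_res_del hk cr Rj) ltnS; apply: IHn => //; first lia.
  by move=> e; apply: ne; rewrite -er e eg.
have er : res_del k r rho = rho.
  apply: res_del_id => // j; apply/negP => Rj; have := h j.
  by rewrite mem_iota Rj -(nth_part_gt0 j pr); case/andP: Rj => _; lia.
rewrite er in inc'; rewrite dg ltnS.
have [<-|/eqP ne'] := eqVneq rho (res_del k r ga); first by [].
by apply: ltnW; apply: IHn => //; lia.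
Qed.

Lemma deg_le_eq k rho ga : 0 < k -> is_core k rho -> is_core k ga ->
  included rho ga -> deg k ga <= deg k rho -> rho = ga.
Proof.
move=> hk cr cg inc le; apply/eqP; apply: contraLR le => /eqP ne.
by rewrite -ltnNge deg_lt.
Qed.

(** * Removing and adding a bottom row *)

Lemma deg_cons k x la : is_part (x :: la) ->
  deg k (x :: la) + nbeads k.+1 (x :: la) k.+1 0 = deg k la + k.+1.
Proof.
move=> px; have /= := @row_deg k (x :: la) k.+1 0 px; rewrite addn0 => /(_ (leqnn _)).
rewrite !deg_rows /= big_nat_recl //= => e.
rewrite -addnA addnC -addnA (addnC _ (count _ _)) e; congr (_ + _).
apply: eq_big_nat => i /andP[_ hi]; apply: eq_in_count => j.
rewrite mem_iota /= add0n => hj; rewrite /hook /= /col_height /=.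
suff -> : j < x by rewrite add1n subSS.
by apply: leq_trans hj _; apply: (@part_anti (x :: la) 0 i.+1 px).
Qed.

Lemma behead_core k la : is_core k la -> is_core k (behead la).
Proof.
move=> cl; have pl := core_part cl.
have pb : is_part (behead la).
  case/andP: pl; case: (la) => //= x s srt; rewrite inE negb_or /is_part.
  by case/andP=> _ ->; rewrite (path_sorted srt).
apply: beads_core => // i.
have [m hm] := (beadP _ _).1 (core_bead cl (bead_row la i.+1)).
have lt : i.+1 < m.
  rewrite ltnNge; apply/negP => le; have := part_anti pl le.
  by move: hm; rewrite /rowend; lia.
exists m.-1; move: hm; rewrite /rowend !nth_behead; case: m lt => //= m _; lia.
Qed.

(** The bead of the bottom row is counted by [nbeads] itself, so this row contributes at most
    [k]. *)
Lemma deg_behead k la : is_part la -> deg k la <= deg k (behead la) + k.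
Proof.
case: la => [|x la] pl; first by rewrite /= leq_addr.
have := deg_cons k pl; have := @nbeadsP k.+1 _ k.+1 0 0 pl; rewrite addn0 leqnn.
by move=> /(_ isT) /=; lia.
Qed.

Lemma add_row_part k la : is_part la -> 0 < k -> is_part (add_row k la).
Proof.
case/andP=> srt nz hk; rewrite /is_part /add_row /= inE negb_or nz andbT.
apply/andP; split; last lia.
by case: la srt {nz} => //= x s ->; rewrite andbT; lia.
Qed.

(** The new bead lies [k.+1] steps to the right of the former rightmost one. The [k] positions
    between them are gaps, which gives the degree below. *)
Lemma add_row_core k la : 0 < k -> is_core k la -> is_core k (add_row k la).
Proof.
move=> hk cl; have pl := core_part cl; apply: beads_core.
  exact: add_row_part.
case=> [|i].
  by exists 1; rewrite /rowend /add_row -nth0 /=; lia.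
have [m] := core_bead cl (bead_row la i); rewrite /rowend => hm.
by exists m.+1; rewrite /rowend /=; lia.
Qed.

Lemma deg_add_row k la : 0 < k -> is_part la -> deg k (add_row k la) = deg k la + k.
Proof.
move=> hk pl; have pa := add_row_part pl hk; have := deg_cons k pa.
have := @nbeadsP k.+1 _ k.+1 0 0 pa; have := @nbeadsP k.+1 _ k.+1 0 1 pa.
rewrite addn0 leqnn /add_row -nth0 => /(_ isT) /= h1 /(_ isT) /=.
by move: h1; set N := nbeads _ _ _ _; case: N => [|[|N]]; lia.
Qed.

(** * Acting with the residues of a window of contents *)

Fixpoint add_window k (R : pred int) m (a : int) mu : seq nat :=
  if m is m'.+1
  then add_window k R m' (a + 1)%R (if R a then res_add k (a %% k.+1)%Z mu else mu)
  else mu.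

(** The residue of [a] is added first by [add_window] but deleted last here, as a composite of
    adjoints requires. *)
Fixpoint del_window k (R : pred int) m (a : int) nu : seq nat :=
  if m is m'.+1
  then let nu' := del_window k R m' (a + 1)%R nu in
       if R a then res_del k (a %% k.+1)%Z nu' else nu'
  else nu.

Definition window_count (R : pred int) m (a : int) : nat :=
  count (fun t : nat => R (a + t%:Z)%R) (iota 0 m).

Lemma window_countS R m a :
  window_count R m.+1 a = R a + window_count R m (a + 1)%R.
Proof.
rewrite /window_count /= addr0; congr (_ + _).
rewrite (iotaDl 1 0) count_map; apply: eq_count => t /=.
by congr (R _ : bool); lia.
Qed.

Lemma add_window_core k R m a mu : 0 < k -> is_core k mu -> is_core k (add_window k R m a mu).
Proof.
move=> hk; elim: m a mu => //= m IHm a mu cm; apply: IHm.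
by case: (R a) => //; apply: res_add_core.
Qed.

Lemma del_window_core k R m a nu : 0 < k -> is_core k nu -> is_core k (del_window k R m a nu).
Proof.
move=> hk cn; elim: m a => //= m IHm a.
by case: (R a) => //; apply: res_del_core.
Qed.

Lemma del_window_part k R m a nu : is_part nu -> is_part (del_window k R m a nu).
Proof.
move=> cn; elim: m a => //= m IHm a.
by case: (R a) => //; apply: res_del_part.
Qed.

Lemma deg_add_window k R m a mu : 0 < k -> is_core k mu ->
  deg k (add_window k R m a mu) <= deg k mu + window_count R m a.
Proof.
move=> hk; elim: m a mu => [|m IHm] a mu cm; first by rewrite /= leq_addr.
rewrite window_countS /=; case: (R a) => /=; last exact: IHm.
apply: leq_trans (IHm _ _ (res_add_core _ hk cm)) _.
by have := deg_res_add_le (a %% k.+1)%Z hk cm; lia.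
Qed.

Lemma deg_del_window k R m a nu : 0 < k -> is_core k nu ->
  deg k nu <= deg k (del_window k R m a nu) + window_count R m a.
Proof.
move=> hk cn; elim: m a => [|m IHm] a; first by rewrite /= leq_addr.
rewrite window_countS /=; have := IHm (a + 1)%R; case: (R a) => //=.
by have := deg_res_del_le (a %% k.+1)%Z hk (del_window_core R m (a + 1)%R hk cn); lia.
Qed.

Lemma del_window_leP k R m a nu mu : is_part nu -> is_part mu ->
  included (del_window k R m a nu) mu <-> included nu (add_window k R m a mu).
Proof.
move=> pn; elim: m a mu => [|m IHm] a mu pm //=.
case: (R a); last exact: IHm.
have pd := del_window_part k R m (a + 1)%R pn.
have <- := IHm (a + 1)%R _ (res_add_part k (a %% k.+1)%Z pm).
split=> /includedP h; apply/includedP; exact/(res_del_leP _ _ pd pm).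
Qed.

Lemma included_res_add k r mu : is_part mu -> included mu (res_add k r mu).
Proof. by move=> pm; apply/includedP => i; rewrite nth_res_add // leq_addr. Qed.

Lemma included_trans mu la nu : included mu la -> included la nu -> included mu nu.
Proof.
by move=> /includedP h1 /includedP h2; apply/includedP => i; apply: leq_trans (h1 i) (h2 i).
Qed.

Lemma add_window_mono k (R R' : pred int) m a mu mu' : is_part mu -> is_part mu' ->
  (forall t, t < m -> R (a + t%:Z)%R -> R' (a + t%:Z)%R) ->
  included mu mu' -> included (add_window k R m a mu) (add_window k R' m a mu').
Proof.
elim: m a mu mu' => //= m IHm a mu mu' pm pm' RR inc.
apply: IHm.
- by case: (R a) => //; apply: res_add_part.
- by case: (R' a) => //; apply: res_add_part.
- by move=> t ht; have := RR t.+1 ht; rewrite intS addrA.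
have := RR 0 isT; rewrite addr0; case: (R a) => [/(_ isT)->|_].
  exact: res_add_mono.
case: (R' a) => //; apply: included_trans inc _; exact: included_res_add.
Qed.

(** The bottom row can pass length [x] only through a cell of content [x]. *)
Lemma add_window_head_le k (R : pred int) m (a : int) mu x : is_part mu ->
  (forall t, t < m -> R (a + t%:Z)%R -> ((a + t%:Z)%R %% k.+1 <> x%:Z %% k.+1)%Z) ->
  nth 0 mu 0 <= x -> nth 0 (add_window k R m a mu) 0 <= x.
Proof.
elim: m a mu => //= m IHm a mu pm hR hx; apply: IHm.
- by case: (R a) => //; apply: res_add_part.
- by move=> t ht; have := hR t.+1 ht; rewrite intS addrA.
have := hR 0 isT; rewrite addr0; case: (R a) => // /(_ isT) ne.
rewrite nth_res_add //; have [lt|gt|e] := ltngtP (nth 0 mu 0) x; try lia.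
rewrite /addable /rowend e subr0; case: eqP => [e2|_] /=; last by rewrite addn0.
by case: ne; rewrite e2.
Qed.

(* Along a row the residues of a strip avoiding one residue occur in the order of
   the window, and each cell becomes addable once the previous one is there. *)
Lemma strip_le_add_window k (R : pred int) m (a : int) mu (f : nat -> nat) :
  is_part mu -> m <= k -> (forall i, f i.+1 <= nth 0 mu i) ->
  (forall i j, nth 0 mu i <= j < f i ->
     exists t, [/\ t < m, R (a + t%:Z)%R &
       ((j%:Z - i%:Z)%R %% k.+1 = (a + t%:Z)%R %% k.+1)%Z]) ->
  forall i, f i <= nth 0 (add_window k R m a mu) i.
Proof.
elim: m a mu => [|m IHm] a mu pm mk fi fR i /=.
  rewrite leqNgt; apply/negP => lt; have := fR i (nth 0 mu i).
  by rewrite leqnn lt => /(_ isT) [t []].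
have inc j : nth 0 mu j <= nth 0 (if R a then res_add k (a %% k.+1)%Z mu else mu) j.
  by case: (R a) => //; rewrite nth_res_add // leq_addr.
apply: IHm => //; first by case: (R a) => //; apply: res_add_part.
- exact: ltnW.
- by move=> j; apply: leq_trans (fi j) (inc j).
move=> i' j /andP[hj1 hj2].
have hj0 := leq_trans (inc i') hj1.
have [|t [ht Rt et]] := fR i' j; first by rewrite hj0.
case: t ht Rt et => [|t] ht Rt et; last first.
  by exists t; split=> //; rewrite -addrA -intS.
exfalso; rewrite addr0 in Rt et; rewrite Rt nth_res_add // in hj1.
have [j0|gtj] := leqP j (nth 0 mu i').
  have ej : nth 0 mu i' = j by apply/eqP; rewrite eqn_leq j0 hj0.
  suff A : addable k (a %% k.+1)%Z mu i' by rewrite A ej in hj1; lia.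
  rewrite /addable /rowend ej et eqxx /=.
  by case: i' hj2 {hj0 hj1 et j0 ej} => //= i' hj2; apply: leq_trans hj2 (fi i').
(* The cell to the left is in the strip too and has the residue of [a - 1], which a window of at
   most [k] contents starting at [a] misses. *)
have [|t [ht' _ et']] := fR i' j.-1; first lia.
have := modz_shift (-1)%R et; have -> : (j%:Z - i'%:Z - 1 = j.-1%:Z - i'%:Z)%R by lia.
by rewrite et' => /modz_close; lia.
Qed.

(** * Horizontal strips of cores *)

Lemma deg_mono k rho ga : 0 < k -> is_core k rho -> is_core k ga ->
  included rho ga -> deg k rho <= deg k ga.
Proof.
move=> hk cr cg inc; have [->//|/eqP ne] := eqVneq rho ga.
exact/ltnW/deg_lt.
Qed.

Lemma modz_nat_bounds k (x : int) : exists2 t, t < k.+1 & (x %% k.+1 = t%:Z)%Z.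
Proof.
have h1 : (0 <= (x %% k.+1)%Z)%R by apply: modz_ge0.
have h2 : ((x %% k.+1)%Z < k.+1%:Z)%R by apply: ltz_pmod.
by exists `|x %% k.+1|%Z; lia.
Qed.

Lemma window_le k (s : seq int) m a : m <= k.+1 ->
  window_count (fun x => (x %% k.+1)%Z \in s) m a <= size (undup s).
Proof.
move=> mk; rewrite /window_count -size_filter.
set F := filter _ _; rewrite -(size_map (fun t : nat => ((a + t%:Z)%R %% k.+1)%Z)).
apply: uniq_leq_size => [|x /mapP[t]]; last first.
  by rewrite mem_filter mem_undup => /andP[h _] ->.
rewrite map_inj_in_uniq ?filter_uniq ?iota_uniq //.
move=> t t'; rewrite !mem_filter !mem_iota => /andP[_ ht] /andP[_ ht'].
by move/modz_close; lia.
Qed.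

Lemma modz_window k (a x : int) :
  exists2 t, t < k.+1 & (x %% k.+1 = (a + t%:Z)%R %% k.+1)%Z.
Proof.
have [t ht e] := modz_nat_bounds k (x - a)%R; exists t => //.
by rewrite -e modzDmr addrC subrK.
Qed.

(** Some residue [r] is missed, and the window of length [k] starting just after it runs through all
    the others. *)
Lemma window_avoiding k (s : seq int) : size (undup s) <= k ->
  exists a : int, forall x : int, (x %% k.+1)%Z \in s ->
    exists2 t, t < k & (x %% k.+1 = (a + t%:Z)%R %% k.+1)%Z.
Proof.
move=> sz; have [r [hr nr]] : exists r : nat, r < k.+1 /\ Posz r \notin s.
  case: (boolP (has (fun r : nat => Posz r \notin s) (iota 0 k.+1))).
    by case/hasP=> r; rewrite mem_iota => /andP[_ hr] nr; exists r.
  move/hasPn => h; exfalso; move: sz; rewrite leqNgt => /negP; apply.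
  rewrite -[k.+1](size_iota 0) -(size_map Posz).
  apply: uniq_leq_size => [|x /mapP[t ht ->]].
    by rewrite map_inj_uniq ?iota_uniq // => x y [].
  by rewrite mem_undup; have := h t ht; rewrite negbK.
exists (r%:Z + 1)%R => x xs; have [t ht e] := modz_window k (r%:Z + 1)%R x.
exists t => //; rewrite ltn_neqAle -ltnS ht andbT; apply: contraNneq nr => tk.
move: xs; rewrite e tk -addrA -intS addrC -{1}(mul1r (Posz k.+1)) modzMDl modz_small //.
Qed.

(** Adding the residues of [s] in the order of a window that avoids a missing residue covers the
    whole strip, and each raises the degree by at most one. *)
Lemma up_strip k mu (f : nat -> nat) (s : seq int) : 0 < k -> is_core k mu ->
  (forall i, f i.+1 <= nth 0 mu i) ->
  (forall i j, nth 0 mu i <= j < f i -> residue k (i, j) \in s) ->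
  size (undup s) <= k ->
  exists ka, [/\ is_core k ka, forall i, f i <= nth 0 ka i &
                 deg k ka <= deg k mu + size (undup s)].
Proof.
move=> hk cm hf hs sz; have [a ha] := window_avoiding sz.
exists (add_window k (fun x => (x %% k.+1)%Z \in s) k a mu); split.
- exact: add_window_core.
- apply: strip_le_add_window (core_part cm) (leqnn k) hf _ => i j /hs xs.
  by have [t ht e] := ha _ xs; exists t; split=> //; rewrite -e.
- apply: leq_trans (deg_add_window _ _ _ hk cm) _; rewrite leq_add2l.
  exact: window_le (leqnSn k).
Qed.

(* When the strip meets every residue, [ka] is [nu] without its bottom row. *)
Lemma down_strip k nu mu (s : seq int) : 0 < k -> is_core k nu -> is_part mu ->
  (forall i, nth 0 nu i.+1 <= nth 0 mu i) ->
  (forall i j, nth 0 mu i <= j < nth 0 nu i -> residue k (i, j) \in s) ->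
  exists ka, [/\ is_core k ka, included ka mu &
                 deg k nu <= deg k ka + minn (size (undup s)) k].
Proof.
move=> hk cn pm hf hs; case: (leqP (size (undup s)) k) => sz; last first.
  exists (behead nu); split; first exact: behead_core.
    by apply/includedP => i; rewrite nth_behead.
  by rewrite deg_behead // (core_part cn).
have [a ha] := window_avoiding sz.
exists (del_window k (fun x => (x %% k.+1)%Z \in s) k a nu); split.
- exact: del_window_core.
- apply/del_window_leP => //; first exact: core_part cn.
  apply/includedP; apply: strip_le_add_window pm (leqnn k) hf _ => i j /hs xs.
  by have [t ht e] := ha _ xs; exists t; split=> //; rewrite -e.
- apply: leq_trans (deg_del_window (fun x => (x %% k.+1)%Z \in s) k a hk cn) _.
  rewrite leq_add2l.
  exact: window_le (leqnSn k).
Qed.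

(** * Weak strips and bottom strong strips *)

Definition skew_residues k (nu mu : seq nat) : seq int :=
  [seq residue k c | c <- skew_cells nu mu].

Definition weak_strip k l la nu : Prop :=
  [/\ 0 < l <= k, is_core k la, is_core k nu, hstrip nu la
    & size (undup (skew_residues k nu la)) = l /\ deg k nu = deg k la + l].

Lemma skew_residuesP k nu la i j :
  nth 0 la i <= j < nth 0 nu i -> residue k (i, j) \in skew_residues k nu la.
Proof. by move=> h; apply: map_f; rewrite mem_skew. Qed.

(* The beads to the left of the first bead of [ka] with the same residue are all
   there, and no bead moves past one of them. *)
Lemma residue_top k la ka i j : is_core k ka -> hstrip ka la ->
  nth 0 la i <= j < nth 0 ka i -> residue k (i, j) <> ((nth 0%N ka 0)%:Z %% k.+1)%Z.
Proof.
move=> ck hs /andP[hj1 hj2] e; have pk := core_part ck.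
have [m hm] : bead ka (j%:Z - i%:Z)%R.
  apply: (core_bead_down ck (bead_row ka 0)); rewrite /rowend subr0 ?e //.
  have := part_anti pk (leq0n i); lia.
have [le|lt] := leqP m i; first by have := part_anti pk le; lia.
case: m lt hm => // m; rewrite ltnS => lt hm.
have := part_anti pk (lt : i < m.+1); case: (hs i) => _; lia.
Qed.

(** The missed residue is that of content [nth 0 la 0 - 1]. Up to this content, a strip cell with
    this residue would have a bead of [la] at the next content, against interlacing. Beyond it only
    the bottom row has strip cells, and it is too short to meet the residue again. *)
Lemma strip_window k la nu i j : is_core k la -> hstrip nu la ->
  nth 0 nu 0 <= nth 0 la 0 + k -> nth 0 la i <= j < nth 0 nu i ->
  exists2 t, t < k &
    ((j%:Z - i%:Z)%R %% k.+1 = ((nth 0%N la 0)%:Z + t%:Z)%R %% k.+1)%Z.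
Proof.
move=> cl hs hd /andP[hj1 hj2]; have pl := core_part cl.
have [t ht e] := modz_window k (Posz (nth 0 la 0)) (j%:Z - i%:Z)%R.
exists t => //; rewrite ltn_neqAle -ltnS ht andbT; apply/eqP => tk.
rewrite {}tk {t ht} in e.
case: (lerP (j%:Z - i%:Z + 1) (nth 0%N la 0)%:Z)%R => cmp.
  have [m hm] : bead la (j%:Z - i%:Z + 1)%R.
    apply: (core_bead_down cl (bead_row la 0)); rewrite /rowend subr0 //.
    rewrite (modz_shift 1 e) -[LHS](modzMDl 1); congr modz; lia.
  have [le|lt] := leqP i m; first by have := part_anti pl le; lia.
  case: i {e hj1 cmp} hj2 hm lt => // i hj2 hm; rewrite ltnS => lt.
  by have := part_anti pl lt; case: (hs i) => _; lia.
case: i {hj1} hj2 e cmp => [|i] hj2 e cmp.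
  by move/modz_close: e; lia.
by case: (hs i) => _; have := part_anti pl (leq0n i); lia.
Qed.

Lemma strong_chain_props k nu ch : is_core k nu ->
  path (fun rho gamma => strong_cover k rho gamma && bottom_right_new rho gamma)
    nu ch ->
  [/\ forall ka, ka \in nu :: ch ->
        [/\ is_core k ka, included nu ka & included ka (last nu ch)]
    & path ltn (head 0 nu) [seq head 0 ka | ka <- ch]].
Proof.
have refl la : included la la by apply/includedP.
elim: ch nu => [|ga ch IHch] nu cn /=.
  by move=> _; split=> // ka; rewrite inE => /eqP->.
case/andP=> /andP[/and4P[_ cg inc _] new] /(IHch _ cg)[H srt]; split.
  move=> ka; rewrite inE => /predU1P[->|/H[cka i1 i2]].
    split=> //; apply: included_trans inc _.
    by have [] := H ga; rewrite ?mem_head.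
  by split=> //; apply: included_trans inc _.
rewrite srt andbT; move: new; rewrite /bottom_right_new mem_skew !nth0; lia.
Qed.

Lemma bottom_strong_strip_weak k l la nu : 0 < k ->
  bottom_strong_strip k l la nu -> weak_strip k l la nu.
Proof.
move=> hk [hl cl cn hs [ch [sz lst pth]]]; have [pl pn] := (core_part cl, core_part cn).
have {}hs : hstrip (add_row k la) nu by apply/hstripP => //; apply: add_row_part.
have hsn : hstrip nu la.
  move=> i; case: (hs i) => _ /= h1; case: (hs i.+1) => /= h2 _; split=> //.
have [H srt] := strong_chain_props cn pth.
have D := strong_chain_deg pth; rewrite lst deg_add_row // sz in D.
have ednu : deg k nu = deg k la + l by lia.
set s := skew_residues k nu la.
pose tops := [seq ((head 0%N ka)%:Z %% k.+1)%Z | ka <- nu :: ch].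
have szt : size tops = k.+1 - l by rewrite size_map /= sz; lia.
(* All bottom rows have lengths among [k.+1] consecutive integers, so distinct lengths are
   incongruent. *)
have hd ka : ka \in nu :: ch -> nth 0 la 0 <= head 0 ka <= nth 0 la 0 + k.
  move=> /H[_ /includedP i1 /includedP i2]; have := i1 0; have := i2 0.
  case: (hsn 0) => + _; rewrite lst /add_row -!nth0 /=; lia.
have ut : uniq tops.
  have srt2 : sorted ltn [seq head 0 ka | ka <- nu :: ch] by [].
  have un := sorted_uniq ltn_trans ltnn srt2.
  have -> : tops = [seq (Posz x %% k.+1)%Z | x <- [seq head 0 ka | ka <- nu :: ch]].
    by rewrite -map_comp.
  rewrite map_inj_in_uniq // => x y /mapP[kx /hd hx ->] /mapP[ky /hd hy ->].
  by move/modz_close; lia.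
have dis : ~~ has (mem (undup s)) tops.
  apply/hasPn => x /mapP[ka hka ->]; apply/negP; rewrite /= mem_undup.
  case/mapP=> -[i j]; rewrite mem_skew => hij e.
  have [cka /includedP i1 /includedP i2] := H _ hka.
  (* [ka] lies between [nu] and [add_row k la], so it interlaces with [la]. *)
  apply: (@residue_top k la ka i j cka) => [i'||]; last by rewrite -e nth0.
    split; first by apply: leq_trans (i1 i'); case: (hsn i').
    by have := i2 i'.+1; rewrite lst.
  by have := i1 i; lia.
have le : size (undup s) <= l.
  have : size (undup s ++ tops) <= k.+1.
    rewrite -[X in _ <= X](size_iota 0) -(size_map Posz).
    apply: uniq_leq_size; first by rewrite cat_uniq undup_uniq ut dis.
    have modP (x : int) : (x %% k.+1)%Z \in [seq Posz t | t <- iota 0 k.+1].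
      have [t ht ->] := modz_nat_bounds k x; apply: map_f; rewrite mem_iota; lia.
    move=> x; rewrite mem_cat mem_undup => /orP[] /mapP[c _ ->]; exact: modP.
  rewrite size_cat szt; lia.
have szk : size (undup s) <= k by lia.
(* For the reverse bound, [nu] lies in a core whose degree exceeds that of [la] by at most the
   number of residues. *)
have [ka [cka incl dka]] := up_strip hk cl (fun i => proj2 (hsn i))
  (@skew_residuesP k nu la) szk.
have := @deg_mono k nu ka hk cn cka; rewrite -/s in dka => dnu.
have {}dnu : deg k nu <= deg k ka by apply: dnu; apply/includedP.
by split=> //; split=> //; rewrite -/s; lia.
Qed.

Lemma weak_strip_bottom_strong k l la nu : 0 < k ->
  weak_strip k l la nu -> bottom_strong_strip k l la nu.
Proof.
move=> hk [hl cl cn hs [szl dnu]]; have [pl pn] := (core_part cl, core_part cn).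
pose s := skew_residues k nu la; pose R (x : int) := (x %% k.+1)%Z \in s.
pose a := Posz (nth 0 la 0); rewrite -/s in szl.
(* If the bottom row grew by more than [k], the strip would meet all [k.+1] residues, but
   [l <= k]. *)
have hd : nth 0 nu 0 <= nth 0 la 0 + k.
  rewrite leqNgt; apply/negP => lt.
  have := @window_le k s k.+1 a (leqnn _); rewrite szl /window_count.
  suff /all_filterP e : all (fun t : nat => R (a + t%:Z)%R) (iota 0 k.+1).
    by rewrite -size_filter e size_iota; lia.
  apply/allP => t; rewrite mem_iota => ht.
  have := @skew_residuesP k nu la 0 (nth 0 la 0 + t); rewrite /residue /= subr0 PoszD.
  by apply; lia.
pose la' := add_row k la.
have hsl : hstrip la' la.
  move=> i; split=> //; case: i => [|i] /=; first by rewrite -nth0 leq_addl.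
  exact: part_anti.
have hsn : hstrip la' nu.
  move=> i; split; last by case: (hs i).
  by case: i => [|i] /=; [rewrite -nth0 addnC|case: (hs i)].
(* Let the residues of the strip, and all those of contents less than [a + t], act
   on [la]: this interpolates between [nu] (t = 0) and [add_row k la] (t = k). *)
pose Rt (t : nat) (x : int) := R x || (x < a + t%:Z)%R.
pose K t := add_window k (Rt t) k a la.
have cK t : is_core k (K t) by apply: add_window_core.
pose c t := count (fun u : nat => ~~ R (a + u%:Z)%R) (iota 0 t).
(* Besides residues of the strip, [Rt t] selects in the window only the [c t] missing ones among its
   first [t] contents. *)
have degK t : t <= k -> deg k (K t) <= deg k nu + c t.
  move=> tk; apply: leq_trans (deg_add_window _ _ _ hk cl) _; rewrite dnu -addnA leq_add2l.
  apply: (@leq_trans (window_count R k a + c t)); last first.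
    by rewrite leq_add2r -szl; apply: window_le.
  rewrite /window_count /c -(subnKC tk) iotaD !count_cat addnAC; apply: leq_add.
    rewrite count_predC; exact: count_size.
  rewrite (eq_in_count (a2 := fun u : nat => R (a + u%:Z)%R)) // => u.
  by rewrite mem_iota /Rt => hu; rewrite orbC (_ : (_ < _)%R = false) //; lia.
(* [nu] lies in [K 0], and the degree bound leaves no room for more. *)
have K0 : K 0 = nu.
  symmetry; apply: (@deg_le_eq k) => //; last by have := degK 0 isT; rewrite addn0.
  apply/includedP; apply: strip_le_add_window => // [i|i j hij]; first by case: (hs i).
  have [t ht e] := strip_window cl hs hd hij; exists t; split=> //.
  by rewrite /Rt /R -e; apply/orP; left; apply: (skew_residuesP k hij).
have Kk : K k = la'.
  symmetry; apply: (@deg_le_eq k) => //; first exact: add_row_core.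
    apply/includedP; apply: strip_le_add_window => // i j hij.
    have [|t ht e] := strip_window cl hsl _ hij; first by rewrite /= -nth0 addnC.
    by exists t; split=> //; rewrite /Rt; apply/orP; right; lia.
  rewrite deg_add_row //; apply: leq_trans (deg_add_window _ _ _ hk cl) _.
  by rewrite leq_add2l -[X in _ <= X](size_iota 0 k) count_size.
have incK t : included (K t) (K t.+1).
  apply: add_window_mono => // [u _|]; last by apply/includedP.
  by rewrite /Rt => /orP[->//|h]; apply/orP; right; lia.
(* In [K t] the residue of [a + t] does not act, so the bottom row stops at length [nth 0 la 0 + t].
   In [K t.+1] all contents from [a] to [a + t] act. *)
have headK t : t < k -> ~~ R (a + t%:Z)%R ->
    nth 0 (K t) 0 <= nth 0 la 0 + t < nth 0 (K t.+1) 0.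
  move=> tk nR; apply/andP; split.
    apply: add_window_head_le => //; last exact: leq_addr.
    move=> u uk; rewrite /Rt PoszD -/a => h /modz_close e.
    have eu : u = t by lia.
    by move: h; rewrite eu (negbTE nR) /=; lia.
  apply: (@strip_le_add_window _ _ _ _ _ (fun i => if i is 0 then (nth 0 la 0 + t).+1 else 0) _ _ _ _ 0) => //.
  move=> [|i] j /andP[h1 h2] //.
  exists (j - nth 0 la 0); rewrite subr0; split; first lia.
    by rewrite /Rt; apply/orP; right; lia.
  by congr modz; lia.
have cS t : c t.+1 = c t + ~~ R (a + t%:Z)%R.
  by rewrite /c -[t.+1]addn1 iotaD count_cat /= addn0 add0n.
(* The bound is attained, since each missing residue lengthens the bottom row and so raises the
   degree. *)
have degK2 t : t <= k -> deg k (K t) = deg k nu + c t.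
  elim: t => [|t IHt] tk; first by rewrite K0 addn0.
  apply/eqP; rewrite eqn_leq degK //= cS.
  have := IHt (ltnW tk); case: (boolP (R (a + t%:Z)%R)) => Rat /= e.
    by rewrite addn0 -e; apply: deg_mono.
  rewrite addn1 addnS -e; apply: deg_lt => // eK; have := headK t tk Rat.
  by rewrite -eK; lia.
(* The chain is built down from [t = k]. A residue of the strip leaves the core unchanged, and its
   step is skipped. *)
have chain d t : t + d = k -> exists ch : seq (seq nat),
    [/\ c t + size ch = c k, last (K t) ch = la'
      & path (fun rho gamma => strong_cover k rho gamma && bottom_right_new rho gamma)
          (K t) ch].
  elim: d t => [|d IHd] t e.
    by exists [::]; rewrite addn0 in e; rewrite e /= addn0 Kk.
  have tk : t < k by lia.
  have [|ch [szc lst pth]] := IHd t.+1; first by rewrite addSnnS.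
  have [d1 d2] := (degK2 t (ltnW tk), degK2 t.+1 tk).
  case: (boolP (R (a + t%:Z)%R)) => Rat; have := cS t; rewrite Rat => /= ec.
    exists ch; have -> : K t = K t.+1 by apply: (@deg_le_eq k) => //; lia.
    by split=> //; lia.
  exists (K t.+1 :: ch); split=> //=; first lia.
  rewrite pth andbT; apply/andP; split; last first.
    by rewrite /bottom_right_new mem_skew; have := headK t tk Rat; rewrite !nth0; lia.
  by rewrite /strong_cover !cK incK /=; apply/eqP; lia.
have [ch [szc lst pth]] := chain k 0 (add0n k).
split=> //; first by apply/hstripP => //; apply: add_row_part.
exists ch; rewrite -K0; split=> //; have := degK2 k (leqnn k).
by rewrite Kk deg_add_row // dnu; move: szc; rewrite {1}/c /=; lia.
Qed.

(** * Tableaux as chains of cores *)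

(* Removing strips from [c r] produces cores inside every [c i]; adding a strip to
   a core [c i] produces a core around [c i.+1]. The hypothesis on the degree forces
   the two cores to coincide. *)
Lemma strip_chain_cores k r (c : nat -> seq nat) (n : nat -> nat) : 0 < k ->
  (forall i, i <= r -> is_part (c i)) -> c 0 = [::] -> is_core k (c r) ->
  (forall i, i < r -> hstrip (c i.+1) (c i)) ->
  (forall i, i < r -> size (undup (skew_residues k (c i.+1) (c i))) = n i) ->
  \sum_(0 <= i < r) n i = deg k (c r) ->
  (forall i, i < r -> n i <= k) /\
  (forall i, i <= r -> is_core k (c i) /\ deg k (c i) = \sum_(0 <= j < i) n j).
Proof.
move=> hk pc c0 cr hs hn sn.
have Dn d : d <= r -> exists ka, [/\ is_core k ka, included ka (c (r - d)) &
    deg k (c r) <= deg k ka + \sum_(r - d <= j < r) minn (n j) k].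
  elim: d => [|d IHd] dr.
    exists (c r); rewrite subn0; split=> //; first by apply/includedP.
    by rewrite big_geq // addn0.
  have [ka [cka /includedP inc dka]] := IHd (ltnW dr).
  have e : r - d = (r - d.+1).+1 by lia.
  have lt : r - d.+1 < r by lia.
  have [|i j hij|ka' [cka' inc' dka']] := @down_strip k ka (c (r - d.+1))
      (skew_residues k (c (r - d)) (c (r - d.+1))) hk cka (pc _ (ltnW lt)).
  - move=> i; apply: leq_trans (inc i.+1) _; rewrite e.
    by case: (hs _ lt i).
  - by apply: skew_residuesP; have := inc i; lia.
  exists ka'; split=> //; rewrite big_ltn // -e.
  by move: dka'; rewrite {1}e hn //; lia.
(* For [d = r] the core found is empty, so the sum of the [n j] is at most that of the
   [minn (n j) k]. *)
have nk i : i < r -> n i <= k.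
  have [ka [cka inc dka]] := Dn r (leqnn r); rewrite subnn c0 in inc dka.
  have ka0 : ka = [::].
    by apply: included_anti => //; apply: core_part cka.
  rewrite ka0 add0n -sn in dka; move=> ir.
  have e : \sum_(0 <= j < r) n j =
      \sum_(0 <= j < r) minn (n j) k + \sum_(0 <= j < r) (n j - k).
    by rewrite -big_split; apply: eq_bigr => j _ /=; lia.
  have : \sum_(0 <= j < r) (n j - k) == 0 by lia.
  rewrite sum_nat_seq_eq0 => /allP/(_ i); rewrite mem_index_iota ir => /(_ isT).
  by rewrite /= subn_eq0.
split=> //; elim=> [|i IHi] ir; first by rewrite c0 big_geq.
have [ci di] := IHi (ltnW ir); have hsi := hs i ir; have ni := hn i ir.
have [|u [cu inc du]] := up_strip hk ci (fun j => proj2 (hsi j))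
  (@skew_residuesP k (c i.+1) (c i)); first by rewrite ni; apply: nk.
have [|ka [cka inck dka]] := Dn (r - i.+1); first exact: leq_subr.
rewrite subKn // in inck dka.
have le : \sum_(i.+1 <= j < r) minn (n j) k <= \sum_(i.+1 <= j < r) n j.
  by apply: leq_sum => j _; apply: geq_minl.
have incu : included (c i.+1) u by apply/includedP.
have sumE : \sum_(0 <= j < r) n j =
    \sum_(0 <= j < i.+1) n j + \sum_(i.+1 <= j < r) n j.
  by rewrite (big_cat_nat (leq0n _) ir).
rewrite ni di in du; rewrite big_nat_recr //= in sumE *.
(* [ka] lies inside [c i.+1] and [u] around it, while the degree of [ka] is at least, and that of
   [u] at most, the same partial sum. *)
have eku : ka = u.
  by apply: (@deg_le_eq k) => //; [apply: included_trans inck incu|lia].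
have -> : c i.+1 = u.
  by apply: included_anti => //; [apply: pc|apply: core_part cu|rewrite -eku].
by rewrite -eku in du *; split=> //; lia.
Qed.

Lemma sorted_countP row x j : sorted leq row -> j < size row ->
  (nth 0 row j <= x) = (j < count (leq^~ x) row).
Proof.
elim: row j => //= y s IHs j srt hj.
case: (leqP y x) => hy /=.
  by case: j hj => [|j] hj //=; rewrite add1n ltnS IHs // (path_sorted srt).
have -> : count (leq^~ x) s = 0.
  apply/eqP; rewrite -leqn0 leqNgt -has_count; apply/hasPn => z zs.
  have /allP/(_ z zs) := order_path_min leq_trans srt; lia.
case: j hj => [|j] /= hj; first by rewrite leqNgt hy.
have /allP/(_ (nth 0 s j) (mem_nth 0 hj)) := order_path_min leq_trans srt; lia.
Qed.

Definition ssyt (nu : seq nat) r (T : seq (seq nat)) : Prop :=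
  [/\ shape T = nu, all (all (fun e => 0 < e <= r)) T, all (sorted leq) T
    & forall i j, (i.+1, j) \in cells nu -> entry T (i, j) < entry T (i.+1, j)].

Definition lower (T : seq (seq nat)) x : seq nat :=
  trim [seq count (leq^~ x) row | row <- T].

Lemma nth_lower T x p : nth 0 (lower T x) p = count (leq^~ x) (nth [::] T p).
Proof.
rewrite nth_trim; case: (ltnP p (size T)) => h; first by rewrite (nth_map [::]).
by rewrite !nth_default ?size_map.
Qed.

Lemma ssyt_row_size nu r T p : ssyt nu r T -> size (nth [::] T p) = nth 0 nu p.
Proof.
case=> <- _ _ _; rewrite /shape; case: (ltnP p (size T)) => h.
  by rewrite (nth_map [::]).
by rewrite !nth_default ?size_map.
Qed.

Lemma ssyt_lowerP nu r T x p j : ssyt nu r T -> j < nth 0 nu p ->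
  (entry T (p, j) <= x) = (j < nth 0 (lower T x) p).
Proof.
move=> sT hj; rewrite nth_lower -sorted_countP ?(ssyt_row_size p sT) //.
case: sT => shT _ /allP srt _; apply: srt; apply: mem_nth.
rewrite ltnNge; apply: contraTN hj => ge.
by rewrite -shT nth_default // size_map.
Qed.

Lemma lower_le nu r T x p : ssyt nu r T -> nth 0 (lower T x) p <= nth 0 nu p.
Proof. by move=> sT; rewrite nth_lower -(ssyt_row_size p sT) count_size. Qed.

Lemma lower_hstrip nu r T x : is_part nu -> ssyt nu r T ->
  hstrip (lower T x.+1) (lower T x).
Proof.
move=> pn sT p; split.
  by rewrite !nth_lower; apply: sub_count => e /= /leqW.
rewrite leqNgt; apply/negP => lt.
set j := nth 0 (lower T x) p in lt.
have hj : j < nth 0 nu p.+1 by apply: leq_trans lt (lower_le _ _ sT).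
have hj' : j < nth 0 nu p by apply: leq_trans hj (part_anti pn _).
have [_ _ _ col] := sT; have := col p j; rewrite mem_cells hj => /(_ isT).
have := ssyt_lowerP x.+1 sT hj; have := ssyt_lowerP x sT hj'.
rewrite -/j ltnn lt => /negbT; rewrite -ltnNge => A B C.
by have := leq_trans A (leq_trans C B); rewrite ltnn.
Qed.

Lemma lower_part nu r T x : is_part nu -> ssyt nu r T -> is_part (lower T x).
Proof.
move=> pn sT; apply: trim_part => p.
rewrite -[leqLHS]nth_trim -[leqRHS]nth_trim -/(lower T x).
by case: (lower_hstrip x pn sT p) (lower_hstrip x pn sT p.+1) => _ h [h' _]; lia.
Qed.

Lemma lower0 nu r T : is_part nu -> ssyt nu r T -> lower T 0 = [::].
Proof.
move=> pn sT; apply: part_ext => // [|p]; first exact: lower_part sT.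
rewrite nth_nil nth_lower; apply/eqP; rewrite -leqn0 leqNgt -has_count.
apply/hasPn => e he; case: sT => _ /allP aT _ _.
case: (ltnP p (size T)) => h; last by rewrite nth_default in he.
have /allP/(_ e he) := aT _ (mem_nth [::] h); lia.
Qed.

Lemma lower_full nu r T x : is_part nu -> ssyt nu r T -> r <= x -> lower T x = nu.
Proof.
move=> pn sT rx; apply: part_ext => // [|p]; first exact: lower_part sT.
rewrite nth_lower -(ssyt_row_size p sT); apply/eqP; rewrite -all_count.
case: sT => _ /allP aT _ _.
case: (ltnP p (size T)) => h; last by rewrite nth_default.
by have := aT _ (mem_nth [::] h); apply: sub_all => e; lia.
Qed.

Lemma num_residues_lower k nu r T x : ssyt nu r T ->
  num_residues k nu T x.+1 =
  size (undup (skew_residues k (lower T x.+1) (lower T x))).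
Proof.
move=> sT; apply: perm_size; apply: perm_undup; apply: eq_mem_map => -[/= p j].
rewrite mem_filter mem_cells mem_skew.
case: (ltnP j (nth 0 nu p)) => hj; last first.
  by rewrite andbF [RHS]andbC ltnNge (leq_trans (lower_le _ _ sT) hj).
rewrite -(ssyt_lowerP x.+1 sT hj) leqNgt -(ssyt_lowerP x sT hj) -ltnNge andbT.
by rewrite eqn_leq andbC; congr (_ && _).
Qed.

(** The entry of a cell is the least [x] such that [lower T x] contains the cell. *)
Lemma ssyt_inj nu r T T' : ssyt nu r T -> ssyt nu r T' ->
  (forall x, x <= r -> lower T x = lower T' x) -> T = T'.
Proof.
move=> sT sT' e.
have sz : size T = size T'.
  by case: sT sT' => <- _ _ _ [/(congr1 size)]; rewrite !size_map.
apply: (eq_from_nth (x0 := [::]) sz) => p hp.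
have szr : size (nth [::] T p) = size (nth [::] T' p).
  by rewrite (ssyt_row_size p sT) (ssyt_row_size p sT').
apply: (eq_from_nth (x0 := 0) szr) => j; rewrite (ssyt_row_size p sT) => hj.
have le1 : entry T (p, j) <= r by case: sT => _ /entry_le h _ _; apply: h.
have le2 : entry T' (p, j) <= r by case: sT' => _ /entry_le h _ _; apply: h.
apply/eqP; rewrite eqn_leq -!/(entry _ (p, j)).
have := ssyt_lowerP (entry T' (p, j)) sT hj.
have := ssyt_lowerP (entry T' (p, j)) sT' hj.
have := ssyt_lowerP (entry T (p, j)) sT hj.
have := ssyt_lowerP (entry T (p, j)) sT' hj.
by rewrite !leqnn !e // => -> <- <- ->.
Qed.

Lemma sumn_take a i : i < size a -> sumn (take i.+1 a) = sumn (take i a) + nth 0 a i.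
Proof. by move=> hi; rewrite (take_nth 0 hi) sumn_rcons. Qed.

Lemma sumn_nth a : sumn a = \sum_(0 <= i < size a) nth 0 a i.
Proof. by rewrite sumnE (big_nth 0). Qed.

(** The common target of the two bijections. *)
Definition is_chain k la (cs : seq (seq nat)) (a : seq nat) : Prop :=
  [/\ size cs = (size a).+1, nth [::] cs 0 = [::], nth [::] cs (size a) = la
    & forall i, i < size a ->
        weak_strip k (nth 0 a i) (nth [::] cs i) (nth [::] cs i.+1)].

Definition tableau_chain (p : seq (seq nat) * seq nat) :
    seq (seq nat) * seq nat :=
  (mkseq (lower p.1) (size p.2).+1, p.2).

Lemma ktableau_ssyt k nu a T : is_ktableau k nu a T -> ssyt nu (size a) T.
Proof. by case=> _ [e h] srt col _; split. Qed.

Lemma tableau_chainP k la a T : 0 < k -> is_core k la -> is_ktableau k la a T ->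
  is_chain k la (mkseq (lower T) (size a).+1) a.
Proof.
move=> hk cl kT; have pl := core_part cl; have sT := ktableau_ssyt kT.
have [/andP[a0 /eqP suma] _ _ _ hw] := kT.
have [||||||nk cc] := @strip_chain_cores k (size a) (lower T) (nth 0 a) hk.
- by move=> i _; apply: lower_part sT.
- exact: lower0 sT.
- by rewrite (lower_full pl sT).
- by move=> i _; apply: lower_hstrip sT.
- by move=> i hi; rewrite -(num_residues_lower k i sT) hw.
- by rewrite -sumn_nth suma (lower_full pl sT).
split; rewrite ?size_mkseq //.
- by rewrite nth_mkseq // (lower0 pl sT).
- by rewrite nth_mkseq // (lower_full pl sT).
move=> i hi; rewrite !nth_mkseq ?ltnS //; last exact: ltnW.
have [c1 d1] := cc i (ltnW hi); have [c2 d2] := cc i.+1 hi.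
split=> //; last 1 first.
- by rewrite -(num_residues_lower k i sT) hw // d1 d2 big_nat_recr.
- rewrite nk // andbT lt0n; apply: contraNneq a0 => <-; exact: mem_nth.
- exact: lower_hstrip sT.
Qed.

Lemma chain_mono k la cs a x y p : is_chain k la cs a -> x <= y -> y <= size a ->
  nth 0 (nth [::] cs x) p <= nth 0 (nth [::] cs y) p.
Proof.
case=> _ _ _ hw; elim: y => [|y IHy]; first by rewrite leqn0 => /eqP->.
rewrite leq_eqVlt => /predU1P[->//|xy] hy.
apply: leq_trans (IHy xy (ltnW hy)) _.
by have [_ _ _ hs _] := hw y hy; case: (hs p).
Qed.

Lemma chain_core k la cs a x : is_core k la -> is_chain k la cs a -> x <= size a ->
  is_core k (nth [::] cs x).
Proof.
move=> cl [_ _ e hw]; rewrite leq_eqVlt => /predU1P[->|/hw[]//].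
by rewrite e.
Qed.

Lemma chain_deg k la cs a : is_chain k la cs a -> deg k la = sumn a.
Proof.
case=> _ c0 cr hw; rewrite -cr -{2}(take_size a).
elim: {-2}(size a) (leqnn (size a)) => [|i IHi] hi; first by rewrite c0 take0.
have [_ _ _ _ [_ ->]] := hw i hi.
by rewrite IHi 1?ltnW // sumn_take.
Qed.

(** A cell receives the number of shapes in the chain that miss it; the empty shape at index 0 makes
    this at least 1. *)
Definition chain_tableau (la : seq nat) (cs : seq (seq nat)) : seq (seq nat) :=
  mkseq (fun p => mkseq (fun j => count (fun c => nth 0 c p <= j) cs) (nth 0 la p))
    (size la).

Lemma entry_chain_tableau la cs p j : is_part la -> j < nth 0 la p ->
  entry (chain_tableau la cs) (p, j) = count (fun c => nth 0 c p <= j) cs.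
Proof.
move=> pl hj; rewrite /entry /= nth_mkseq ?nth_mkseq //.
by rewrite -nth_part_gt0 //; lia.
Qed.

Lemma chain_countP k la cs a x p j : is_chain k la cs a -> x <= size a ->
  (nth 0 (nth [::] cs x) p <= j) = (x < count (fun c => nth 0 c p <= j) cs).
Proof.
move=> hc hx; have [sz _ _ _] := hc.
pose P x := (x <= size a) && (nth 0 (nth [::] cs x) p <= j).
have H := @count_downclosed P (size a).+1.
transitivity (P x); first by rewrite /P hx.
rewrite H; first last.
- by move=> m /andP[].
- move=> y z yz /andP[hz h]; rewrite /P (leq_trans yz hz) /=.
  exact: leq_trans (chain_mono p hc yz hz) h.
congr (_ < _); rewrite -[X in _ = count _ X](mkseq_nth [::] cs) sz count_map.
by apply: eq_in_count => y; rewrite mem_iota /P /= add0n ltnS => ->.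
Qed.

Lemma chain_tableau_ssyt k la cs a : is_core k la -> is_chain k la cs a ->
  ssyt la (size a) (chain_tableau la cs).
Proof.
move=> cl hc; have pl := core_part cl; have [sz c0 cr hw] := hc.
split.
- apply: (@eq_from_nth _ 0); rewrite size_map size_mkseq // => p hp.
  by rewrite (nth_map [::]) ?size_mkseq // nth_mkseq // size_mkseq.
- apply/allP => row /mapP[p _ ->]; apply/allP => e /mapP[j]; rewrite mem_iota => hj ->.
  rewrite -(chain_countP _ _ hc (leq0n _)) c0 nth_nil /= leqNgt.
  by rewrite -(chain_countP _ _ hc (leqnn _)) cr -ltnNge; lia.
- apply/allP => row /mapP[p _ ->]; apply/(sortedP 0) => j; rewrite size_mkseq => hj.
  rewrite !nth_mkseq //; last exact: ltnW.
  by apply: sub_count => c /= /leqW.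
move=> p j; rewrite mem_cells => hj.
have hj' : j < nth 0 la p by apply: leq_trans hj (part_anti pl _).
rewrite !entry_chain_tableau //; set e := count _ cs; set e' := count _ cs.
have e'r : e' <= size a.
  by rewrite leqNgt -(chain_countP _ _ hc (leqnn _)) cr -ltnNge.
have e'0 : 0 < e' by rewrite -(chain_countP _ _ hc (leq0n _)) c0 nth_nil.
(* The upper cell is in the shape of index [e'], so by interlacing the cell below it is already in
   that of index [e'.-1]. *)
have := chain_countP p.+1 j hc e'r; rewrite -/e' ltnn => /negbT; rewrite -ltnNge.
have lt : e'.-1 < size a by lia.
have [_ _ _ hs _] := hw _ lt; rewrite prednK // in hs.
have := chain_countP p j hc (ltnW lt); rewrite -/e; case: (hs p) => _; lia.
Qed.

Lemma lower_chain_tableau k la cs a x : is_core k la -> is_chain k la cs a ->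
  x <= size a -> lower (chain_tableau la cs) x = nth [::] cs x.
Proof.
move=> cl hc hx; have pl := core_part cl; have sT := chain_tableau_ssyt cl hc.
have pc := core_part (chain_core cl hc hx).
apply: part_ext => // [|p]; first exact: lower_part sT.
have le1 := lower_le x p sT; have le2 := chain_mono p hc hx (leqnn _).
have [_ _ cr _] := hc; rewrite cr in le2.
have H j : j < nth 0 la p ->
    (j < nth 0 (lower (chain_tableau la cs) x) p) = (j < nth 0 (nth [::] cs x) p).
  move=> hj; rewrite -(ssyt_lowerP x sT hj) entry_chain_tableau //.
  by rewrite leqNgt -(chain_countP _ _ hc hx) -ltnNge.
have [lt|lt|//] := ltngtP (nth 0 (lower (chain_tableau la cs) x) p)
                          (nth 0 (nth [::] cs x) p).
  by have := H _ (leq_trans lt le2); rewrite ltnn lt.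
by have := H _ (leq_trans lt le1); rewrite ltnn lt.
Qed.

Lemma chain_tableauP k la cs a : is_core k la -> is_chain k la cs a ->
  is_ktableau k la a (chain_tableau la cs).
Proof.
move=> cl hc; have sT := chain_tableau_ssyt cl hc; have [sh al srt col] := sT.
have [_ _ _ hw] := hc.
split=> //.
  rewrite (chain_deg hc) eqxx andbT; apply/negP => /(nthP 0)[i hi e].
  by have [] := hw i hi; rewrite e.
case=> // i hi; rewrite (num_residues_lower k i sT) !(lower_chain_tableau cl hc) //=.
  by have [_ _ _ _ []] := hw i hi.
exact: ltnW.
Qed.

(** * Counter-tableaux as chains of cores *)

(** The test inside [inner]: an empty cell acts as an infinite entry. *)
Definition exceeds (x : nat) (o : option nat) : bool :=
  if o is Some e then x < e else true.

Lemma counter_row_countP x row j : counter_row row -> j < size row ->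
  exceeds x (nth None row j) = (j < count (exceeds x) row).
Proof.
case=> m [s [-> srt]] hj; set row' := _ ++ _ in hj *.
pose P y := (y < size row') && exceeds x (nth None row' y).
have H := @count_downclosed P (size row').
transitivity (P j); first by rewrite /P hj.
rewrite H; first last.
- by move=> y /andP[].
- move=> y z yz /andP[hz h]; rewrite /P (leq_ltn_trans yz hz) /=.
  move: h hz; rewrite /row' !nth_cat !size_cat !size_nseq size_map.
  case: (ltnP y m) => [ym|my]; first by move=> _ _; rewrite nth_nseq ym.
  rewrite ltnNge (leq_trans my yz) /= => + hz.
  rewrite !(nth_map 0) /=; try lia; move/leq_trans; apply.
  apply: (sorted_leq_nth (leT := geq)) => //; rewrite ?inE; try lia.
  + by move=> a b c /= ba cb; apply: leq_trans cb ba.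
  + by move=> a /=.
congr (_ < _); rewrite -[X in _ = count _ X](mkseq_nth None row') count_map.
by apply: eq_in_count => y; rewrite mem_iota /P /= add0n => ->.
Qed.

Lemma nth_inner A x p : x <= size A ->
  nth 0 (inner A x) p = if p < x then count (exceeds x) (arow A (x - p)) else 0.
Proof.
move=> hx; rewrite nth_trim; have sz : size (rev (take x A)) = x.
  by rewrite size_rev size_takel.
case: ltnP => hp; last by rewrite nth_default // size_map sz.
rewrite (nth_map [::]) ?sz // nth_rev ?size_takel // nth_take; last lia.
by rewrite /arow; have -> : (x - p).-1 = x - p.+1 by lia.
Qed.

(** Thresholds from [i] to [r] separate the entries in this range, and the threshold [r] separates
    them from an empty cell. *)
Lemma exceeds_inj i r (o o' : option nat) :
  (forall e, o = Some e -> i <= e <= r) -> (forall e, o' = Some e -> i <= e <= r) ->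
  (forall x, i <= x <= r -> exceeds x o = exceeds x o') -> i <= r -> o = o'.
Proof.
move=> ho ho' E ir; case: o ho E => [e|] ho E; case: o' ho' E => [e'|] ho' E //.
- congr Some; apply/eqP; have h := ho e erefl; have h' := ho' e' erefl.
  by have := E _ h; have := E _ h'; rewrite /= !ltnn eqn_leq => *; apply/andP; lia.
- have h := ho e erefl; have := E r; rewrite ir leqnn /= => /(_ isT); lia.
- have h := ho' e' erefl; have := E r; rewrite ir leqnn /= => /(_ isT); lia.
Qed.

Definition ABC_chain (p : array * seq nat) : seq (seq nat) * seq nat :=
  (mkseq (inner p.1) (size p.2).+1, p.2).

Lemma ABC_chainP k la a A : 0 < k -> is_ABC k a A -> inner A (size A) = la ->
  is_chain k la (mkseq (inner A) (size a).+1) a.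
Proof.
move=> hk [_ sA _ hw] hla; split; rewrite ?size_mkseq //.
- by rewrite nth_mkseq // /inner take0.
- by rewrite nth_mkseq // -sA.
move=> i hi; rewrite !nth_mkseq ?ltnS //; last exact: ltnW.
by have [_ _ _ /(bottom_strong_strip_weak hk)] := hw i.+1 hi.
Qed.

(** The last row taken is the bottom of the shape, so row [i] of the array becomes part [x - i] of
    the x-th shape. *)
Lemma ABC_cell k a A i x j : is_ABC k a A -> 0 < i -> i <= x -> x <= size a ->
  j < size (arow A i) ->
  exceeds x (nth None (arow A i) j) = (j < nth 0 (inner A x) (x - i)).
Proof.
case=> _ sA [hr _ _] _ i0 ix xr hj.
rewrite nth_inner ?sA // subKn // counter_row_countP //; last by apply: hr; lia.
by have -> : x - i < x by lia.
Qed.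

Lemma ABC_inj k a A A' : is_ABC k a A -> is_ABC k a A' ->
  (forall x, x <= size a -> inner A x = inner A' x) -> A = A'.
Proof.
move=> hA hA' E; have [_ sA [_ _ ub] hw] := hA; have [_ sA' [_ _ ub'] hw'] := hA'.
apply: (@eq_from_nth _ [::]); rewrite sA ?sA' // => i hi.
have [_ sz lb _] := hw i.+1 hi; have [_ sz' lb' _] := hw' i.+1 hi.
have szE : size (arow A i.+1) = size (arow A' i.+1) by rewrite sz sz' E // ltnW.
apply: (@eq_from_nth _ None) => // j hj.
apply: (@exceeds_inj i.+1 (size a)) => //.
- move=> e he; have m : Some e \in arow A i.+1 by rewrite -he mem_nth.
  by have := ub i.+1 e; rewrite sA => /(_ hi m); have := lb e m; lia.
- move=> e he; have m : Some e \in arow A' i.+1 by rewrite -he mem_nth // -szE.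
  by have := ub' i.+1 e; rewrite sA' => /(_ hi m); have := lb' e m; lia.
move=> x /andP[ix xr].
transitivity (j < nth 0 (inner A x) (x - i.+1)); first exact: (ABC_cell (i := i.+1) hA).
rewrite E //; symmetry; apply: (ABC_cell (i := i.+1) hA') => //.
by move: hj; rewrite -/(arow A i.+1) szE.
Qed.

(* The entry in row [i] and column [j] is the first [x] such that column [j] is not
   covered by the part of the x-th shape lying in row [i]. *)
Definition chain_row k (cs : seq (seq nat)) i : seq (option nat) :=
  let r := (size cs).-1 in
  let m := nth 0 (nth [::] cs r) (r - i) in
  let L := k + head 0 (nth [::] cs i.-1) in
  nseq m None ++
  [seq Some e | e <-
    [seq i + count (fun y => j < nth 0 (nth [::] cs (y + i)) y) (iota 0 (r.+1 - i))
     | j <- iota m (L - m)]].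

Definition chain_ABC k (cs : seq (seq nat)) : array :=
  mkseq (fun i => chain_row k cs i.+1) (size cs).-1.

Lemma chain_size k la cs a x p : is_chain k la cs a -> x <= size a -> x <= p ->
  nth 0 (nth [::] cs x) p = 0.
Proof.
case=> _ c0 _ hw; elim: x p => [|x IHx] p hx hp; first by rewrite c0 nth_nil.
case: p hp => // p hp; apply/eqP; rewrite -leqn0.
apply: leq_trans _ (eq_leq (IHx p (ltnW hx) hp)).
by have [_ _ _ hs _] := hw x hx; case: (hs p).
Qed.

(** For fixed [i] these parts all lie in row [i] of the array, in successive shapes; each
    interlacing step bounds one by the previous one. *)
Lemma chain_diag k la cs a i y z : is_chain k la cs a -> y <= z -> z + i <= size a ->
  nth 0 (nth [::] cs (z + i)) z <= nth 0 (nth [::] cs (y + i)) y.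
Proof.
case=> _ _ _ hw; elim: z => [|z IHz]; first by rewrite leqn0 => /eqP->.
rewrite leq_eqVlt => /predU1P[->//|yz] hz.
apply: leq_trans (IHz yz (ltnW hz)).
by have [_ _ _ hs _] := hw (z + i) hz; case: (hs z).
Qed.

(** The largest of these parts is the bottom row of the i-th core, which fits into [add_row] of the
    core before it because the quotient is a bottom strong strip. *)
Lemma chain_row_bounds k la cs a i : 0 < k -> is_chain k la cs a -> 0 < i <= size a ->
  nth 0 (nth [::] cs (size a)) (size a - i) <= k + head 0 (nth [::] cs i.-1) /\
  forall x, i <= x <= size a ->
    nth 0 (nth [::] cs x) (x - i) <= k + head 0 (nth [::] cs i.-1).
Proof.
move=> hk hc /andP[i0 ir].
have H x : i <= x <= size a ->
    nth 0 (nth [::] cs x) (x - i) <= k + head 0 (nth [::] cs i.-1).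
  case/andP=> ix xr; have := @chain_diag k la cs a i 0 (x - i) hc (leq0n _).
  rewrite subnK // => /(_ xr); move/leq_trans; apply; rewrite add0n.
  have lt : i.-1 < size a by lia.
  have [_ _ _ hw] := hc.
  have [_ cl cn hs _] := weak_strip_bottom_strong hk (hw _ lt).
  have /(hstripP (add_row_part (core_part cl) hk) (core_part cn))/(_ 0)[] := hs.
  by rewrite prednK.
by split=> //; apply: H; rewrite ir leqnn.
Qed.

Lemma size_chain_row k la cs a i : 0 < k -> is_chain k la cs a -> 0 < i <= size a ->
  size (chain_row k cs i) = k + head 0 (nth [::] cs i.-1).
Proof.
move=> hk hc hi; have [sz _ _ _] := hc.
rewrite /chain_row sz /= size_cat size_nseq !size_map size_iota.
by have [h _] := chain_row_bounds hk hc hi; rewrite subnKC.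
Qed.

Lemma chain_row_counter k cs i : counter_row (chain_row k cs i).
Proof.
eexists; eexists; split; first reflexivity.
apply/(sortedP 0) => j; rewrite size_map size_iota => hj.
rewrite !(nth_map 0) ?size_iota ?nth_iota //; try lia.
by rewrite /geq /= leq_add2l; apply: sub_count => y /=; lia.
Qed.

Lemma chain_row_exceeds k la cs a i x j : 0 < k -> is_chain k la cs a ->
  0 < i <= size a -> i <= x <= size a -> j < size (chain_row k cs i) ->
  exceeds x (nth None (chain_row k cs i) j) = (j < nth 0 (nth [::] cs x) (x - i)).
Proof.
move=> hk hc hi hx; rewrite (size_chain_row hk hc hi) => hj.
have [sz _ _ _] := hc; have [mL _] := chain_row_bounds hk hc hi.
have dg y z : y <= z -> z + i <= size a -> _ := @chain_diag k la cs a i y z hc.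
rewrite /chain_row sz /= nth_cat size_nseq; move: mL.
set m := nth 0 _ (size a - i) => mL.
have ex : x - i + i = x by lia.
have er : size a - i + i = size a by lia.
case: (ltnP j m) => jm.
  rewrite nth_nseq jm /=; symmetry; apply: leq_trans jm _.
  have := dg (x - i) (size a - i); rewrite ex er; apply; lia.
rewrite (nth_map 0) ?size_map ?size_iota; last lia.
rewrite (nth_map 0) ?size_iota; last lia.
rewrite nth_iota; last lia.
rewrite /= subnKC //.
pose P y := (y + i <= size a) && (j < nth 0 (nth [::] cs (y + i)) y).
have H := @count_downclosed P ((size a).+1 - i).
have -> : count (fun y => j < nth 0 (nth [::] cs (y + i)) y)
             (iota 0 ((size a).+1 - i)) = count P (iota 0 ((size a).+1 - i)).
  by apply: eq_in_count => y; rewrite mem_iota /P => hy; have -> : y + i <= size a by lia.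
have Px : P (x - i) = (j < nth 0 (nth [::] cs x) (x - i)).
  by rewrite /P ex; case/andP: hx => _ ->.
rewrite -Px H; first by apply/idP/idP; lia.
- move=> y z yz /andP[hz h]; rewrite /P; apply/andP; split; first lia.
  by apply: leq_trans h (dg y z yz hz).
- by move=> y /andP[h _]; lia.
Qed.

Lemma chain_row_entries k la cs a i e : 0 < k -> is_chain k la cs a ->
  0 < i <= size a -> Some e \in chain_row k cs i -> i <= e <= size a.
Proof.
move=> hk hc hi he; have [sz _ _ _] := hc.
have /(nthP None)[j hj ej] := he; apply/andP; split.
  move: he; rewrite mem_cat mem_nseq andbF /= => /mapP[e' + [->]].
  by case/mapP=> y _ ->; rewrite leq_addr.
(* A larger entry would put its cell into the last shape, whose cells in this row are empty by
   construction. *)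
rewrite leqNgt; apply/negP => lt.
have := chain_row_exceeds hk hc hi _ hj (x := size a); rewrite ej /= lt leqnn.
case/andP: (hi) => _ -> /(_ isT) /esym h; move: he hj ej h.
rewrite /chain_row sz /= nth_cat size_nseq => _ _ + h.
by rewrite h nth_nseq h.
Qed.

Lemma arow_chain_ABC k la cs a i : is_chain k la cs a -> 0 < i <= size a ->
  arow (chain_ABC k cs) i = chain_row k cs i.
Proof.
case=> sz _ _ _ /andP[i0 ir]; rewrite /arow nth_mkseq; last by rewrite sz /=; lia.
by rewrite prednK.
Qed.

Lemma inner_chain_ABC k la cs a x : 0 < k -> is_core k la -> is_chain k la cs a ->
  x <= size a -> inner (chain_ABC k cs) x = nth [::] cs x.
Proof.
move=> hk cl hc hx; have [sz _ _ _] := hc.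
have pc := core_part (chain_core cl hc hx).
have szA : size (chain_ABC k cs) = size a by rewrite size_mkseq sz.
have E p : nth 0 (inner (chain_ABC k cs) x) p = nth 0 (nth [::] cs x) p.
  rewrite nth_inner ?szA //; case: ltnP => hp; last by rewrite (chain_size hc).
  have hi : 0 < x - p <= size a by lia.
  have hxi : x - p <= x <= size a by lia.
  rewrite (arow_chain_ABC hc hi).
  have [_ /(_ x hxi)] := chain_row_bounds hk hc hi.
  rewrite -(size_chain_row hk hc hi) subKn ?(ltnW hp) // => le2.
  have le1 := count_size (exceeds x) (chain_row k cs (x - p)).
  have H j : j < size (chain_row k cs (x - p)) ->
      (j < count (exceeds x) (chain_row k cs (x - p))) = (j < nth 0 (nth [::] cs x) p).
    move=> hj; rewrite -counter_row_countP //; last exact: chain_row_counter.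
    by rewrite (chain_row_exceeds hk hc hi hxi hj) subKn // ltnW.
  have [lt|lt|//] := ltngtP (count (exceeds x) (chain_row k cs (x - p)))
                            (nth 0 (nth [::] cs x) p).
    by have := H _ (leq_trans lt le2); rewrite ltnn lt.
  by have := H _ (leq_trans lt le1); rewrite ltnn lt.
apply: part_ext => //; apply: trim_part => p.
by rewrite -[leqLHS]nth_trim -[leqRHS]nth_trim -/(inner _ x) !E part_anti.
Qed.

Lemma chain_ABCP k la cs a : 0 < k -> is_core k la -> is_chain k la cs a ->
  is_ABC k a (chain_ABC k cs).
Proof.
move=> hk cl hc; have [sz _ _ hw] := hc.
have szA : size (chain_ABC k cs) = size a by rewrite size_mkseq sz.
split=> //.
- by apply/(all_nthP 0) => i hi; have [] := hw i hi.
- split; rewrite ?szA.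
  + by move=> i hi; rewrite (arow_chain_ABC hc hi); apply: chain_row_counter.
  + move=> i i' j e e' i0 ii' he he'.
    have rng t b : nth None (arow (chain_ABC k cs) t) j = Some b -> 0 < t ->
        t <= size a /\ j < size (arow (chain_ABC k cs) t).
      move=> h t0; split; rewrite leqNgt; apply/negP => h2.
        by move: h; rewrite /arow (nth_default [::]) ?nth_nil // szA; lia.
      by rewrite nth_default in h.
    have [ir hj] := rng i e he i0; have [i'r hj'] := rng i' e' he' (ltn_trans i0 ii').
    have hi : 0 < i <= size a by lia.
    have hi' : 0 < i' <= size a by lia.
    rewrite (arow_chain_ABC hc hi) in he hj; rewrite (arow_chain_ABC hc hi') in he' hj'.
    have be := chain_row_entries hk hc hi (e := e).
    have be' := chain_row_entries hk hc hi' (e := e').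
    rewrite -he mem_nth // in be; rewrite -he' mem_nth // in be'.
    have {}be := be isT; have {}be' := be' isT.
    (* If [e' <= e], column [j] is covered by row [i] in shape [e.-1] but not by row [i'] in shape
       [e]. This is impossible: shapes grow, and row [i'] sits below row [i]. *)
    rewrite ltnNge; apply/negP => le.
    have he1 : i <= e.-1 <= size a by lia.
    have he2 : i' <= e <= size a by lia.
    have := chain_row_exceeds hk hc hi he1 hj.
    have := chain_row_exceeds hk hc hi' he2 hj'.
    rewrite he he' /= ltnNge le prednK ?leqnn; last lia.
    move=> /esym/negbT; rewrite -leqNgt => h1 /esym h2.
    have lt : e.-1 <= e by lia.
    have m := chain_mono (e.-1 - i) hc lt (proj2 (andP he2)).
    have p := part_anti (core_part (chain_core cl hc (proj2 (andP he2))))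
                (_ : e - i' <= e.-1 - i).
    by have := p ltac:(lia); lia.
  + move=> i e hi; rewrite (arow_chain_ABC hc hi) => /(chain_row_entries hk hc hi); lia.
move=> i hi; have lt : i.-1 < size a by lia.
have ir : i <= size a by lia.
rewrite !(inner_chain_ABC hk cl hc) ?(ltnW lt) //.
rewrite !(chain_core cl hc) ?(ltnW lt) // (arow_chain_ABC hc hi).
split=> //; first exact: size_chain_row hc hi.
  by move=> e /(chain_row_entries hk hc hi)/andP[].
by have := weak_strip_bottom_strong hk (hw _ lt); rewrite prednK //; lia.
Qed.

(** * The two bijections and the identity *)

Definition chains k la : set (seq (seq nat) * seq nat) :=
  [set p | is_chain k la p.1 p.2]%classic.

Lemma tableau_chain_bij k la : 0 < k -> is_core k la ->
  set_bij (ktableaux k la) (chains k la) tableau_chain.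
Proof.
move=> hk cl; have pl := core_part cl; split.
- by move=> [T a] /= hT; apply: tableau_chainP hT.
- move=> [T a] [T' a'] /set_mem /= hT /set_mem /= hT' E.
  have /= e := congr1 fst E; have /= ea := congr1 snd E; subst a'.
  congr (_, _); apply: ssyt_inj (ktableau_ssyt hT) (ktableau_ssyt hT') _ => x hx.
  have /(congr1 (fun s => nth [::] s x)) := e.
  by rewrite !nth_mkseq.
- move=> [cs a] /= hc; exists (chain_tableau la cs, a) => /=.
    exact: chain_tableauP hc.
  rewrite /tableau_chain /=; congr (_, _); have [sz _ _ _] := hc.
  apply: (@eq_from_nth _ [::]); rewrite size_mkseq ?sz // => x hx.
  by rewrite nth_mkseq // (lower_chain_tableau cl hc).
Qed.

Lemma ABC_chain_bij k la : 0 < k -> is_core k la ->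
  set_bij (ABCs k la) (chains k la) ABC_chain.
Proof.
move=> hk cl; have pl := core_part cl; split.
- by move=> [A a] /= [hA e]; apply: ABC_chainP.
- move=> [A a] [A' a'] /set_mem /= [hA _] /set_mem /= [hA' _] E.
  have /= e := congr1 fst E; have /= ea := congr1 snd E; subst a'.
  congr (_, _); apply: ABC_inj hA hA' _ => x hx.
  have /(congr1 (fun s => nth [::] s x)) := e.
  by rewrite !nth_mkseq.
- move=> [cs a] /= hc; have [sz _ cr _] := hc.
  have szA : size (chain_ABC k cs) = size a by rewrite size_mkseq sz.
  exists (chain_ABC k cs, a) => /=.
    by split; [apply: chain_ABCP hc|rewrite szA (inner_chain_ABC hk cl hc)].
  rewrite /ABC_chain /=; congr (_, _).
  apply: (@eq_from_nth _ [::]); rewrite size_mkseq ?sz // => x hx.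
  by rewrite nth_mkseq // (inner_chain_ABC hk cl hc).
Qed.

Theorem theorem4p1 (k : nat) (hk : (0 < k)%N) (la : seq nat)
    (hla : is_core k la) :
  finite_set (ABCs k la) /\
  dual_kschur k la = (\sum_(p \in ABCs k la) xpow p.2)%R.
Proof.
have bT := tableau_chain_bij hk hla; have bA := ABC_chain_bij hk hla.
split.
  case: bT bA => _ _ surT [funA injA _].
  (* Finiteness passes from tableaux onto chains, and back along the injection of arrays into
     chains. *)
  rewrite -(eq_finite_set (inj_card_eq injA)).
  apply: (@sub_finite_set _ _ (chains k la)) => [_ [p hp <-]|]; first exact: funA.
  exact: sub_finite_set surT (finite_image _ (finite_ktableaux k la)).
rewrite /dual_kschur -(reindex_fsbig tableau_chain _ _ (fun p => xpow p.2) bT).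
by rewrite -(reindex_fsbig ABC_chain _ _ (fun p => xpow p.2) bA).
Qed.
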